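(* Let $\mathfrak g$ be a complex simple Lie algebra with root system $\Delta$, positive roots $\Delta^+$ and simple roots $\Pi=\{\alpha_1,\dots,\alpha_n\}$. For $I\in\mathrm{Ab}(\mathfrak g)$, let $z_I\in Q^\vee$ be the element defined below, write $z_I=\sum_{i=1}^n m_i\alpha_i^\vee$ with $m_i\in\mathbb Z$, and set $S_I=\{\alpha_i\in\Pi\mid m_i\text{ is odd}\}$. Then the map $I\mapsto S_I$ is a bijection between $\mathrm{Ab}(\mathfrak g)$ and the set $2^\Pi$ of all subsets of $\Pi$.
   Context: $\mathrm{Ab}(\mathfrak g)$ is the set of subsets $I\subseteq\Delta^+$ that are upper ideals for the root order ($\nu\preccurlyeq\mu$ iff $\mu-\nu$ is a non-negative integral combination of simple roots) and satisfy $\gamma'+\gamma''\notin\Delta^+$ for all $\gamma',\gamma''\in I$; these are identified with the abelian ideals of the Borel subalgebra. Let $V=\bigoplus_i\mathbb R\alpha_i$ with a $W$-invariant inner product $(\ ,\ )$, $\mu^\vee=2\mu/(\mu,\mu)$, $Q^\vee=\bigoplus_i\mathbb Z\alpha_i^\vee$ the coroot lattice, and $\theta$ the highest root. Let $\widehat V=V\oplus\mathbb R\delta\oplus\mathbb R\lambda$ with $(\ ,\ )$ extended by $(\delta,V)=(\lambda,V)=(\delta,\delta)=(\lambda,\lambda)=0$, $(\delta,\lambda)=1$. Set $\alpha_0=\delta-\theta$, $\widehat\Delta^+=\Delta^+\cup\{\Delta+k\delta\mid k\ge1\}$, and let $\widehat W\subset GL(\widehat V)$ be the affine Weyl group generated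 by the reflections $s_i(x)=x-(x,\alpha_i)\alpha_i^\vee$, $i=0,\dots,n$. For $w\in\widehat W$ let $\mathcal N(w)=\{\nu\in\widehat\Delta^+\mid w(\nu)\in-\widehat\Delta^+\}$. An element $w\in\widehat W$ is minuscule if $\mathcal N(w)=\{\delta-\gamma\mid\gamma\in I_w\}$ for some $I_w\subset\Delta$; it is known (Peterson, Kostant) that $w\mapsto I_w$ is a bijection between minuscule elements of $\widehat W$ and $\mathrm{Ab}(\mathfrak g)$; let $w_I$ denote the minuscule element with $I_{w_I}=I$. Writing $w_I^{-1}(\alpha_i)=\mu_i+k_i\delta$ with $\mu_i\in\Delta$, $k_i\in\mathbb Z$ ($i=1,\dots,n$), $z_I$ is the unique element of $Q^\vee$ with $(z_I,\alpha_i)=k_i$ for all $i=1,\dots,n$ (equivalently, if $w_I=v\cdot t_r$ with $v\in W$ and $t_r$ the translation by $r\in Q^\vee$, then $z_I=v(r)$). *)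

(* Defs.v *)
From HB Require Import structures.
From mathcomp Require Import all_boot all_order all_algebra.
From mathcomp Require Import boolp classical_sets functions cardinality reals.

Set Implicit Arguments.
Unset Strict Implicit.
Unset Printing Implicit Defensive.

Import Order.TTheory GRing.Theory Num.Theory.

Local Open Scope classical_set_scope.
Local Open Scope ring_scope.

(* A complex simple Lie algebra enters only through its root system, i.e.
   through an (arbitrary) irreducible reduced crystallographic root system,
   given here as a finite subset Delta of a Euclidean space (V, ip) together
   with a base alpha. *)

Record inner_product (R : realType) (V : vectType R) (ip : V -> V -> R)
    : Prop := InnerProduct {
  ip_linear : forall (a : R) (u v w : V),
    ip (a *: u + v) w = a * ip u w + ip v w;
  ip_sym : forall u v : V, ip u v = ip v u;
  ip_pos : forall u : V, u != 0 -> 0 < ip u u }.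

(* For an arbitrary form on a real vector space, so that it applies both to V
   and to the (indefinite) extended space. *)
Definition coroot (R : realType) (U : lmodType R) (form : U -> U -> R) (a : U)
    : U := (2 / form a a) *: a.

Definition reflection (R : realType) (U : lmodType R) (form : U -> U -> R)
    (a x : U) : U := x - form x a *: coroot form a.

(* The reflections are orthogonal for ip, so the W-invariance of ip is built
   in. *)
Record root_system (R : realType) (V : vectType R) (ip : V -> V -> R)
    (Delta : set V) : Prop := RootSystem {
  rs_finite : finite_set Delta;
  rs_not0 : ~ Delta 0;
  rs_reduced : forall (a : V) (c : R),
    Delta a -> Delta (c *: a) -> c = 1 \/ c = -1;
  rs_refl : forall a b : V, Delta a -> Delta b -> Delta (reflection ip a b);
  rs_int : forall a b : V, Delta a -> Delta b ->
    ip b (coroot ip a) \is a Num.int }.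

Record irreducible_system (R : realType) (V : vectType R) (ip : V -> V -> R)
    (Delta : set V) : Prop := IrreducibleSystem {
  irr_nonempty : Delta !=set0;
  irr_connected : forall D : set V, D `<=` Delta ->
    (forall a b : V, D a -> (Delta `\` D) b -> ip a b = 0) ->
    D = set0 \/ D = Delta }.

Definition root_le (R : realType) (V : vectType R) (n : nat)
    (alpha : 'I_n -> V) (nu mu : V) : Prop :=
  exists c : 'I_n -> nat, mu - nu = \sum_(i < n) alpha i *+ c i.

(* That Delta spans V follows from root_basis. *)
Record simple_roots (R : realType) (V : vectType R) (Delta : set V) (n : nat)
    (alpha : 'I_n -> V) : Prop := SimpleRoots {
  simple_root : forall i : 'I_n, Delta (alpha i);
  simple_basis : basis_of fullv (codom alpha);
  simple_sign : forall g : V, Delta g ->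
    root_le alpha 0 g \/ root_le alpha g 0 }.

Definition pos_roots (R : realType) (V : vectType R) (Delta : set V) (n : nat)
    (alpha : 'I_n -> V) : set V :=
  [set g | Delta g /\ root_le alpha 0 g].

Definition highest_root (R : realType) (V : vectType R) (Delta : set V)
    (n : nat) (alpha : 'I_n -> V) (theta : V) : Prop :=
  Delta theta /\ forall g : V, Delta g -> root_le alpha g theta.

Definition Ab (R : realType) (V : vectType R) (Delta : set V) (n : nat)
    (alpha : 'I_n -> V) : set (set V) :=
  [set I : set V |
    [/\ I `<=` pos_roots Delta alpha,
        forall nu mu : V, I nu -> pos_roots Delta alpha mu ->
          root_le alpha nu mu -> I mu
      & forall g1 g2 : V, I g1 -> I g2 ->
          ~ pos_roots Delta alpha (g1 + g2)]].

(* The triple (v, a, b) stands for v + a delta + b lambda. *)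
Definition hatV (R : realType) (V : vectType R) : lmodType R :=
  (V * R^o * R^o)%type.

Definition hat_ip (R : realType) (V : vectType R) (ip : V -> V -> R)
    (x y : hatV V) : R :=
  ip x.1.1 y.1.1 + x.1.2 * y.2 + x.2 * y.1.2.

Definition hat_inj (R : realType) (V : vectType R) (v : V) : hatV V :=
  (v, 0, 0).

Definition hat_delta (R : realType) (V : vectType R) : hatV V := (0, 1, 0).

Definition hat_pos_roots (R : realType) (V : vectType R) (Delta : set V)
    (n : nat) (alpha : 'I_n -> V) : set (hatV V) :=
  [set hat_inj g | g in pos_roots Delta alpha] `|`
  [set x | exists (g : V) (k : nat),
    [/\ Delta g, (1 <= k)%N & x = hat_inj g + hat_delta V *+ k]].

Definition hat_simple (R : realType) (V : vectType R) (n : nat)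
    (alpha : 'I_n -> V) (theta : V) (i : option 'I_n) : hatV V :=
  if i is Some j then hat_inj (alpha j) else hat_delta V - hat_inj theta.

(* The group generated by s_0, ..., s_n, as a group of bijections of the
   extended space; the index None is 0 and Some i is i. *)
Inductive affine_weyl (R : realType) (V : vectType R) (ip : V -> V -> R)
    (n : nat) (alpha : 'I_n -> V) (theta : V) : (hatV V -> hatV V) -> Prop :=
| affine_weyl_gen (i : option 'I_n) :
    affine_weyl ip alpha theta
      (reflection (hat_ip ip) (hat_simple alpha theta i))
| affine_weyl_id : affine_weyl ip alpha theta id
| affine_weyl_comp (v w : hatV V -> hatV V) :
    affine_weyl ip alpha theta v -> affine_weyl ip alpha theta w ->
    affine_weyl ip alpha theta (v \o w)
| affine_weyl_inv (w w' : hatV V -> hatV V) :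
    affine_weyl ip alpha theta w -> cancel w w' -> cancel w' w ->
    affine_weyl ip alpha theta w'.

Definition inversion_set (R : realType) (V : vectType R) (Delta : set V)
    (n : nat) (alpha : 'I_n -> V) (w : hatV V -> hatV V) : set (hatV V) :=
  [set nu | hat_pos_roots Delta alpha nu /\
            hat_pos_roots Delta alpha (- w nu)].

(* w is a minuscule element with I_w = I *)
Definition minuscule_with (R : realType) (V : vectType R) (ip : V -> V -> R)
    (Delta : set V) (n : nat) (alpha : 'I_n -> V) (theta : V) (I : set V)
    (w : hatV V -> hatV V) : Prop :=
  [/\ affine_weyl ip alpha theta w, I `<=` Delta
    & inversion_set Delta alpha w = [set hat_delta V - hat_inj g | g in I]].

(* For I in Ab the element w_I exists and is unique (Peterson, Kostant), so
   the default value of xget is irrelevant; likewise for z_I below. *)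
Definition w_of (R : realType) (V : vectType R) (ip : V -> V -> R)
    (Delta : set V) (n : nat) (alpha : 'I_n -> V) (theta : V) (I : set V)
    : hatV V -> hatV V :=
  @xget (hatV V -> hatV V) id [set w | minuscule_with ip Delta alpha theta I w].

Definition coroot_comb (R : realType) (V : vectType R) (ip : V -> V -> R)
    (n : nat) (alpha : 'I_n -> V) (m : 'I_n -> int) : V :=
  \sum_(i < n) coroot ip (alpha i) *~ m i.

Definition coroot_lattice (R : realType) (V : vectType R) (ip : V -> V -> R)
    (n : nat) (alpha : 'I_n -> V) : set V := range (coroot_comb ip alpha).

(* w_I^-1 (alpha_i) = mu + k delta is written alpha_i = w_I (mu + k delta). *)
Definition z_of (R : realType) (V : vectType R) (ip : V -> V -> R)
    (Delta : set V) (n : nat) (alpha : 'I_n -> V) (theta : V) (I : set V)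
    : V :=
  xget 0 [set z | coroot_lattice ip alpha z /\
    forall i : 'I_n, exists (mu : V) (k : int),
      [/\ Delta mu,
          w_of ip Delta alpha theta I (hat_inj mu + hat_delta V *~ k)
            = hat_inj (alpha i)
        & ip z (alpha i) = k%:~R]].

Definition S_of (R : realType) (V : vectType R) (ip : V -> V -> R)
    (Delta : set V) (n : nat) (alpha : 'I_n -> V) (theta : V) (I : set V)
    : set V :=
  [set a | exists (m : 'I_n -> int) (i : 'I_n),
    [/\ z_of ip Delta alpha theta I = coroot_comb ip alpha m,
        odd `|m i|%N & a = alpha i]].

(* Main.v *)
(* Writing the minuscule element w_I as t_z v, the condition that w_I be minuscule
   says exactly that -1 <= (z, g) <= 2 for every positive root g, so I |-> z_I
   identifies Ab with the set Z of such z in Q^vee, and S_I records the class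
   of z_I modulo 2Q^vee.  Each class meets Z exactly once.  Existence: take
   the point of the class nearest to rho^vee / h; comparing it with its
   translates by +-2 g^vee bounds |(z - rho^vee / h, g)| by 2.  Uniqueness: two
   points of Z in one class differ by 2q with |(q, g)| <= 1 for all roots g, and
   0 is the only such q in Q^vee. *)
Require Import Defs.
From mathcomp Require Import all_boot all_order all_algebra.
From mathcomp Require Import boolp classical_sets functions cardinality reals.
From mathcomp Require Import ring lra zify.

Import Order.TTheory GRing.Theory Num.Theory.

Local Open Scope classical_set_scope.
Local Open Scope ring_scope.

(** [w_of] and [z_of] choose by [xget], so the existence and uniqueness of w_I are proved here: an
    element is determined by its inversion set (exchange argument), and w_I is built by adding the
    roots of I one at a time. The bounds -1 and 2 come from the affine roots 2 delta + g: a
    minuscule element inverts only roots with delta-coefficient 1, so it keeps these positive;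
    conversely this, together with positivity on Pi, forces all inversions to have coefficient 1.
    The coset t_z W contains only one element positive on Pi, which is why z determines I. The
    centre rho^vee / h is chosen because (rho^vee / h, g) = ht g / h lies strictly between 0 and 1
    for g > 0; this and integrality turn a distance of at most 2 into -1 <= (z, g) <= 2. *)

Lemma count_lt (T : eqType) (p q : pred T) (s : seq T) (x : T) :
  x \in s -> q x -> ~~ p x -> {in s, forall y, p y -> q y} ->
  (count p s < count q s)%N.
Proof.
move=> xs qx px pq; rewrite !(permP (perm_to_rem xs)) /= qx (negbTE px).
rewrite add0n add1n ltnS; have : {subset rem x s <= s} by apply: mem_rem.
elim: (rem x s) => //= y r IH sub; apply: leq_add.
  have : p y ==> q y by apply/implyP/pq/sub/mem_head.
  by case: (p y) => //= ->.
by apply: IH => z zr; apply: sub; rewrite in_cons zr orbT.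
Qed.

(** * Reflections *)

Section Forms.
Set Implicit Arguments.
Unset Strict Implicit.
Variables (R : realType) (U : lmodType R) (form : U -> U -> R).
Hypothesis form_lin : forall (a : R) (u v w : U),
  form (a *: u + v) w = a * form u w + form v w.
Hypothesis form_sym : forall u v : U, form u v = form v u.

Lemma formDl u v w : form (u + v) w = form u w + form v w.
Proof. by rewrite -[u in LHS]scale1r form_lin mul1r. Qed.

Lemma form0l w : form 0 w = 0.
Proof.
have /eqP := form_lin 1 0 0 w.
by rewrite scaler0 addr0 mul1r -subr_eq subrr eq_sym => /eqP.
Qed.

Lemma formZl a u w : form (a *: u) w = a * form u w.
Proof. by rewrite -[a *: u]addr0 form_lin form0l addr0. Qed.

Lemma formNl u w : form (- u) w = - form u w.
Proof. by rewrite -scaleN1r formZl mulN1r. Qed.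

Lemma formDr u v w : form w (u + v) = form w u + form w v.
Proof. by rewrite form_sym formDl ![form _ w]form_sym. Qed.

Lemma formZr a u w : form w (a *: u) = a * form w u.
Proof. by rewrite form_sym formZl form_sym. Qed.

Lemma formNr u w : form w (- u) = - form w u.
Proof. by rewrite form_sym formNl form_sym. Qed.

Lemma formMzl (u w : U) (m : int) : form (u *~ m) w = m%:~R * form u w.
Proof. by rewrite -scaler_int formZl. Qed.

Lemma form_suml (I : Type) (s : seq I) (F : I -> U) w :
  form (\sum_(i <- s) F i) w = \sum_(i <- s) form (F i) w.
Proof.
by elim: s => [|i s IH]; rewrite ?big_nil ?form0l // !big_cons formDl IH.
Qed.

Lemma form_corootr x a : form x (coroot form a) = 2 * form x a / form a a.
Proof. by rewrite /coroot formZr mulrAC. Qed.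

Lemma reflectionE a x :
  reflection form a x = x - form x (coroot form a) *: a.
Proof.
by rewrite /reflection form_corootr /coroot scalerA mulrA [_ * 2]mulrC.
Qed.

Lemma reflection_lin a (c : R) x y :
  reflection form a (c *: x + y)
  = c *: reflection form a x + reflection form a y.
Proof.
rewrite /reflection form_lin scalerDl opprD scalerBr -scalerA.
by rewrite addrACA.
Qed.

Lemma coroot_isometry (w : U -> U) a :
  (forall (c : R) x y, w (c *: x + y) = c *: w x + w y) ->
  (forall x y, form (w x) (w y) = form x y) ->
  coroot form (w a) = w (coroot form a).
Proof.
move=> wl wi; rewrite /coroot wi.
have w0 : w 0 = 0.
  by have := wl (-1) 0 0; rewrite scaler0 add0r scaleN1r addNr.
by rewrite -[in RHS](addr0 (_ *: a)) wl w0 addr0.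
Qed.

Lemma reflection_conj (w : U -> U) a x :
  (forall (c : R) x y, w (c *: x + y) = c *: w x + w y) ->
  (forall x y, form (w x) (w y) = form x y) ->
  w (reflection form a x) = reflection form (w a) (w x).
Proof.
move=> wl wi; rewrite /reflection coroot_isometry // wi.
by rewrite -scaleNr addrC wl addrC scaleNr.
Qed.

Variable a : U.
Hypothesis a_aniso : form a a != 0.

Lemma form_coroot_self : form a (coroot form a) = 2.
Proof. by rewrite form_corootr mulfK. Qed.

Lemma reflection_self : reflection form a a = - a.
Proof.
by rewrite reflectionE form_coroot_self scalerDl scale1r opprD addrA subrr add0r.
Qed.

Lemma reflection_isometry x y :
  form (reflection form a x) (reflection form a y) = form x y.
Proof.
rewrite !reflectionE !form_corootr !formDl !formDr !formNl !formNr.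
by rewrite !formZl !formZr (form_sym a y); field.
Qed.

Lemma reflectionK x : reflection form a (reflection form a x) = x.
Proof.
rewrite (reflectionE a x) reflectionE formDl formNl formZl form_coroot_self.
rewrite -addrA -opprD -scalerDl; set c := form x _.
have -> : c + (c - c * 2) = 0 by ring.
by rewrite scale0r subr0.
Qed.

Lemma reflectionN x : reflection form (- a) x = reflection form a x.
Proof.
rewrite !reflectionE !form_corootr !formNl !formNr opprK scalerN mulrN mulNr.
by rewrite scaleNr opprK.
Qed.
End Forms.

(** * Roots and affine roots *)

Section AbelianIdeals.
Set Implicit Arguments.
Unset Strict Implicit.
Variables (R : realType) (V : vectType R) (ip : V -> V -> R)
  (Delta : set V) (n : nat) (alpha : 'I_n -> V) (theta : V).
Hypotheses (hip : inner_product ip) (hDelta : root_system ip Delta)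
  (halpha : simple_roots Delta alpha)
  (htheta : highest_root Delta alpha theta).

Let ip_lin := ip_linear hip.
Let ip_symm := ip_sym hip.
Let ipDl := formDl ip_lin.
Let ipDr := formDr ip_lin ip_symm.
Let ipNl := formNl ip_lin.
Let ipNr := formNr ip_lin ip_symm.
Let ipZl := formZl ip_lin.
Let ipZr := formZr ip_lin ip_symm.
Let ip0l := form0l ip_lin.

Local Notation cor := (coroot ip).
Local Notation refl := (reflection ip).

Lemma root_neq0 a : Delta a -> a != 0.
Proof. by move=> Da; apply/eqP => a0; apply: (rs_not0 hDelta); rewrite -a0. Qed.

Lemma root_pos a : Delta a -> 0 < ip a a.
Proof. by move=> /root_neq0; apply: ip_pos. Qed.

Lemma root_aniso a : Delta a -> ip a a != 0.
Proof. by move=> /root_pos; apply: lt0r_neq0. Qed.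

Lemma rootN a : Delta a -> Delta (- a).
Proof.
move=> Da; rewrite -(reflection_self ip_lin ip_symm (root_aniso Da)).
exact: rs_refl.
Qed.

Lemma corootN a : cor (- a) = - cor a.
Proof. by rewrite /coroot ipNl ipNr opprK scalerN. Qed.

Lemma pairing_int a b : Delta a -> Delta b ->
  exists m : int, ip b (cor a) = m%:~R.
Proof. by move=> Da Db; apply/intrP; apply: (rs_int hDelta). Qed.

Lemma pairing_gt0 a b : Delta a -> (0 < ip b (cor a)) = (0 < ip b a).
Proof.
move=> /root_pos a0; rewrite form_corootr // pmulr_lgt0 ?invr_gt0 //.
by rewrite pmulr_rgt0.
Qed.

(** The product of the two pairings is 4 cos^2 of the angle, hence below 4 by strict Cauchy-Schwarz;
    of two positive integers with product at most 3, one is 1. *)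
Lemma pairing_eq1 a b : Delta a -> Delta b -> 0 < ip a b -> a <> b ->
  ip a (cor b) = 1 \/ ip b (cor a) = 1.
Proof.
move=> Da Db ab0 nab.
have [m mE] := pairing_int Db Da; have [k kE] := pairing_int Da Db.
have m0 : 0 < ip a (cor b) by rewrite pairing_gt0.
have k0 : 0 < ip b (cor a) by rewrite pairing_gt0 // ip_symm.
have pa := root_pos Da; have pb := root_pos Db.
suff mk4 : ip a (cor b) * ip b (cor a) < 4.
  rewrite mE kE in m0 k0 mk4 *.
  have {}mk4 : m * k < 4 by rewrite -(ltr_int R) intrM.
  rewrite ltr0z in m0; rewrite ltr0z in k0.
  have [->|->] : m = 1 \/ k = 1 by nia.
  - by left.
  - by right.
rewrite !form_corootr // (ip_symm b a).
have -> : 2 * ip a b / ip b b * (2 * ip a b / ip a a)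
  = 4 * (ip a b ^+ 2 / (ip a a * ip b b)).
  by field; rewrite !lt0r_neq0.
rewrite gtr_pMr // ltr_pdivrMr ?mulr_gt0 // mul1r.
(* [c *: b] is the projection of [a] on [b]. The squared length of [a - c *: b] gives the strict
   inequality; it cannot vanish, since reducedness would leave only a = b or a = -b. *)
pose c := ip a b / ip b b.
have cE : c * ip b b = ip a b by rewrite /c divfK // lt0r_neq0.
have [d0|d0] := eqVneq (a - c *: b) 0.
  exfalso; have aE : a = c *: b by apply/eqP; rewrite -subr_eq0 d0.
  have := rs_reduced hDelta Db (c := c); rewrite -aE => /(_ Da) [c1|c1].
    by apply: nab; rewrite aE c1 scale1r.
  by move: cE; rewrite c1 => cE; lra.
have := ip_pos hip d0.
rewrite ipDl !ipDr !ipNl !ipNr !ipZl !ipZr (ip_symm b a) => h.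
have h2 : 0 < ip a a - c * ip a b.
  by move: h; rewrite mulrA -(mulrA c) cE; lra.
have : 0 < (ip a a - c * ip a b) * ip b b by rewrite mulr_gt0.
rewrite mulrBl mulrAC cE expr2; lra.
Qed.

(** When one pairing is 1, the difference is, up to sign, the reflection of one root in the
    other. *)
Lemma root_sub a b : Delta a -> Delta b -> 0 < ip a b -> a <> b ->
  Delta (a - b).
Proof.
move=> Da Db ab0 nab; have [h|h] := pairing_eq1 Da Db ab0 nab.
  by have := rs_refl hDelta Db Da; rewrite reflectionE // h scale1r.
have := rs_refl hDelta Da Db; rewrite reflectionE // h scale1r => /rootN.
by rewrite opprB.
Qed.

Lemma coroot_refl a b : Delta a -> cor (refl a b) = refl a (cor b).
Proof.
move=> Da; apply: coroot_isometry => //.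
  exact: reflection_lin.
exact: (reflection_isometry ip_lin ip_symm (root_aniso Da)).
Qed.

(** Unless a = -b, [pairing_eq1] for [a] and [- b] makes one pairing equal to -1. The corresponding
    reflection adds the two coroots, and a reflected coroot is the coroot of the reflected root. *)
Lemma coroot_add a b : Delta a -> Delta b -> ip a b < 0 ->
  cor a + cor b = 0 \/ exists2 c, Delta c & cor a + cor b = cor c.
Proof.
move=> Da Db ab0; have [ab|nab] := pselect (a = - b).
  by left; rewrite ab corootN addNr.
have nab0 : 0 < ip a (- b) by rewrite ipNr; lra.
right; have [h|h] := pairing_eq1 Da (rootN Db) nab0 nab.
  exists (refl a b); first exact: rs_refl.
  rewrite coroot_refl // /reflection (ip_symm _ a).
  have -> : ip a (cor b) = - 1 by move: h; rewrite corootN ipNr; lra.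
  by rewrite scaleN1r opprK addrC.
exists (refl b a); first exact: rs_refl.
rewrite coroot_refl // /reflection (ip_symm _ b).
have -> : ip b (cor a) = - 1 by move: h; rewrite ipNl; lra.
by rewrite scaleN1r opprK.
Qed.

(** * Coordinates and positivity of affine roots *)

Let atup : n.-tuple V := mktuple alpha.
Local Notation co := (coord atup).

Lemma simple_tuple_basis : basis_of fullv atup.
Proof. by have := simple_basis halpha; congr (basis_of _ _). Qed.

Lemma simple_expand (v : V) : v = \sum_(i < n) co i v *: alpha i.
Proof.
rewrite {1}(coord_basis simple_tuple_basis (memvf v)).
by apply: eq_bigr => i _; rewrite -tnth_nth tnth_mktuple.
Qed.

Lemma coord_simple i j : co i (alpha j) = (j == i)%:R.
Proof.
have := basis_free simple_tuple_basis => /coord_free <-.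
by rewrite -tnth_nth tnth_mktuple.
Qed.

Lemma coord_root_le nu mu i : root_le alpha nu mu ->
  exists c : nat, co i mu - co i nu = c%:R.
Proof.
move=> [c cE]; exists (c i); rewrite -linearB cE linear_sum /=.
rewrite (bigD1 i) //= big1 => [|j ji].
  by rewrite linearMn /= coord_simple eqxx addr0.
by rewrite linearMn /= coord_simple (negbTE ji) mul0rn.
Qed.

Lemma coord_theta_ge g i : Delta g -> exists c : nat,
  co i theta - co i g = c%:R.
Proof. by move=> Dg; apply: coord_root_le; apply: htheta.2. Qed.

Lemma coord_sign g : Delta g ->
  (forall i, exists c : nat, co i g = c%:R) \/
  (forall i, exists c : nat, co i g = - c%:R).
Proof.
move=> /(simple_sign halpha) [] h; [left|right] => i;
  have [c cE] := coord_root_le i h; exists c; rewrite linear0 in cE; lra.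
Qed.

Lemma coord_theta i : exists c : nat, co i theta = c%:R.
Proof.
have Dt := htheta.1.
have [c cE] := coord_theta_ge i (rootN Dt); rewrite linearN /= in cE.
have [|] := coord_sign Dt => /(_ i) [d dE]; first by exists d.
by exists 0; have : (0 : R) <= c%:R by []; have : (0 : R) <= d%:R by []; lra.
Qed.

Local Notation hat := (hatV V).
Local Notation hf := (hat_ip ip).
Local Notation asimple := (hat_simple alpha theta).

Lemma hat_lin (c : R) (u v w : hat) :
  hf (c *: u + v) w = c * hf u w + hf v w.
Proof.
have -> : hf (c *: u + v) w = ip (c *: u.1.1 + v.1.1) w.1.1
    + (c * u.1.2 + v.1.2) * w.2 + (c * u.2 + v.2) * w.1.2 by [].
by rewrite ip_lin /hat_ip; ring.
Qed.

Lemma hat_symm (u v : hat) : hf u v = hf v u.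
Proof. by rewrite /hat_ip ip_symm; ring. Qed.

Definition affine_root (g : V) (k : int) : hat := (g, k%:~R, 0).

Definition real_root (x : hat) : Prop :=
  exists g k, Delta g /\ x = affine_root g k.

Lemma hf_affine g k h l : hf (affine_root g k) (affine_root h l) = ip g h.
Proof. by rewrite /hat_ip /= mulr0 mul0r !addr0. Qed.

Lemma affine_simple i : asimple (Some i) = affine_root (alpha i) 0.
Proof. by []. Qed.

Lemma affine_simple0 : asimple None = affine_root (- theta) 1.
Proof.
rewrite /= /affine_root /hat_inj /hat_delta.
by congr (_, _, _); rewrite /= ?sub0r ?subr0 ?oppr0.
Qed.

Lemma real_simple i : real_root (asimple i).
Proof.
case: i => [i|].
  by exists (alpha i), 0; split=> //; apply: simple_root halpha _.
by exists (- theta), 1; rewrite affine_simple0; split=> //; apply: rootN htheta.1.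
Qed.

Lemma real_aniso x : real_root x -> hf x x != 0.
Proof. by move=> [g [k [Dg ->]]]; rewrite hf_affine root_aniso. Qed.

Lemma affineZD (c : R) g h (a b : R) :
  ((h, b, 0) : hat) - c *: ((g, a, 0) : hat) = (h - c *: g, b - c * a, 0).
Proof. by congr (_, _, _); rewrite /= scaler0 subr0. Qed.

Lemma hat_reflE g (k : R) h (l : R) :
  reflection hf ((g, k, 0) : hat) ((h, l, 0) : hat)
  = (refl g h, l - ip h (cor g) * k, 0).
Proof.
rewrite (reflectionE hat_lin hat_symm) (form_corootr hat_lin hat_symm).
rewrite /hat_ip /= !mulr0 !mul0r !addr0 affineZD.
by rewrite -(form_corootr ip_lin ip_symm) -(reflectionE ip_lin ip_symm).
Qed.

Lemma real_refl x y : real_root x -> real_root y ->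
  real_root (reflection hf x y).
Proof.
move=> [g [k [Dg ->]]] [h [l [Dh ->]]].
have [m mE] := pairing_int Dg Dh.
exists (refl g h), (l - m * k); split; first exact: rs_refl.
by rewrite hat_reflE mE /affine_root intrD mulrNz intrM.
Qed.

(** Coefficients on alpha_0, ..., alpha_n: as delta = alpha_0 + theta, v + k delta = k alpha_0 + (v
    + k theta). The lambda component is ignored. *)
Definition hco (j : option 'I_n) (x : hat) : R :=
  if j is Some i then co i (x.1.1 + (x.1.2 : R) *: theta) else x.1.2.

Lemma hco_lin j (c : R) (x y : hat) :
  hco j (c *: x + y) = c * hco j x + hco j y.
Proof.
case: j => [i|] //; rewrite /hco.
have -> : (c *: x + y).1.1 + ((c *: x + y).1.2 : R) *: theta
    = c *: (x.1.1 + (x.1.2 : R) *: theta) + (y.1.1 + (y.1.2 : R) *: theta).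
  rewrite [c *: (x.1.1 + _)]scalerDr scalerA addrACA -scalerDl.
  by [].
by rewrite linearP.
Qed.

Lemma hcoD j x y : hco j (x + y) = hco j x + hco j y.
Proof. by rewrite -[x in LHS]scale1r hco_lin mul1r. Qed.

Lemma hco0 j : hco j 0 = 0.
Proof. by have := hcoD j 0 0; rewrite addr0 => h; lra. Qed.

Lemma hcoZ j (c : R) x : hco j (c *: x) = c * hco j x.
Proof. by rewrite -[c *: x]addr0 hco_lin hco0 addr0. Qed.

Lemma hcoN j x : hco j (- x) = - hco j x.
Proof. by rewrite -scaleN1r hcoZ mulN1r. Qed.

Lemma hco_simple j i : hco j (asimple i) = (i == j)%:R.
Proof.
case: i => [i|]; case: j => [j|].
- by rewrite /= scale0r addr0 coord_simple.
- by [].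
- by rewrite affine_simple0 /= scale1r addNr linear0.
- by rewrite affine_simple0.
Qed.

Lemma sum_option (W : zmodType) (F : option 'I_n -> W) :
  \sum_j F j = F None + \sum_i F (Some i).
Proof.
rewrite (bigD1 None) //=; congr (_ + _).
by rewrite (reindex_omap Some id) => [|[]] //; apply: eq_bigl => i; rewrite eqxx.
Qed.

Lemma hco_expand (x : hat) : x.2 = 0 -> x = \sum_j hco j x *: asimple j.
Proof.
case: x => [[g k] l] /= ->; rewrite sum_option.
have -> : \sum_i hco (Some i) (g, k, 0) *: asimple (Some i)
   = hat_inj (\sum_i hco (Some i) (g, k, 0) *: alpha i).
  elim/big_ind2: _ => [|x1 x2 y1 y2 -> ->|i _] //.
    by congr (_, _, _); rewrite addr0.
  by congr (_, _, _); rewrite /= scaler0.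
rewrite -simple_expand affine_simple0.
congr (_, _, _); rewrite /= ?scaler0 ?addr0 ?mulr1 //.
  by rewrite scalerN addrC addrK.
by rewrite [k *: _]mulr1.
Qed.

Lemma real_opp x : real_root x -> real_root (- x).
Proof.
move=> [g [k [Dg ->]]]; exists (- g), (- k); split; first exact: rootN.
by rewrite /affine_root mulrNz; congr (_, _, _); rewrite /= oppr0.
Qed.

(** For k >= 1, g + k theta = (theta - (-g)) + (k - 1) theta has non-negative coordinates because
    theta dominates -g. Negation settles k <= -1, and k = 0 is the sign property of the base. *)
Lemma real_sign x : real_root x ->
  (forall j, exists c : nat, hco j x = c%:R) \/
  (forall j, exists c : nat, hco j x = - c%:R).
Proof.
have pos g (k : nat) : Delta g ->
    forall j, exists c : nat, hco j (affine_root g k.+1%:Z) = c%:R.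
  move=> Dg [i|]; last by exists k.+1.
  have [c cE] := coord_theta_ge i (rootN Dg); have [d dE] := coord_theta i.
  exists (c + k * d)%N; rewrite /= linearD linearZ /= natrD natrM -cE -dE.
  rewrite linearN /= -[k.+1%:~R]/(k.+1%:R) -natr1.
  ring.
move=> [g [k [Dg ->]]]; case: (intP k) => [|{}k|{}k].
- have [h|h] := coord_sign Dg; [left|right] => -[i|].
  + by rewrite /= scale0r addr0.
  + by exists 0.
  + by rewrite /= scale0r addr0.
  + by exists 0; rewrite oppr0.
- by left; apply: pos.
- right=> j; have [c cE] := pos _ k (rootN Dg) j; exists c.
  rewrite -cE -hcoN; congr hco; rewrite /affine_root mulrNz.
  by congr (_, _, _); rewrite /= ?opprK ?oppr0.
Qed.

(* The height of an affine root, extended to a linear form on the whole space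
   so that the sign of a real root is the sign of a linear form. *)
Definition aht (x : hat) : R := \sum_j hco j x.

Lemma ahtD x y : aht (x + y) = aht x + aht y.
Proof. by rewrite /aht -big_split; apply: eq_bigr => j _; apply: hcoD. Qed.

Lemma ahtZ c x : aht (c *: x) = c * aht x.
Proof. by rewrite /aht mulr_sumr; apply: eq_bigr => j _; apply: hcoZ. Qed.

Lemma ahtN x : aht (- x) = - aht x.
Proof. by rewrite -scaleN1r ahtZ mulN1r. Qed.

Lemma aht_simple i : aht (asimple i) = 1.
Proof.
rewrite /aht (bigD1 i) //= big1 => [|j /negbTE ji].
  by rewrite hco_simple eqxx addr0.
by rewrite hco_simple eq_sym ji.
Qed.

Lemma real_neq0 x : real_root x -> x != 0.
Proof.
move=> xr; apply: contraNneq (real_aniso xr) => ->.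
by rewrite (form0l hat_lin).
Qed.

Lemma real_lambda x : real_root x -> x.2 = 0.
Proof. by move=> [g [k [_ ->]]]. Qed.

Lemma aht_neq0 x : real_root x -> aht x != 0.
Proof.
move=> xr; apply: contraNneq (real_neq0 xr) => a0.
rewrite [x]hco_expand ?real_lambda // big1 // => j _.
suff -> : hco j x = 0 by rewrite scale0r.
have [h|h] := real_sign xr.
  have h0 i : true -> 0 <= hco i x by have [c ->] := h i.
  by move: a0 => /(psumr_eq0P h0) ->.
have h0 i : true -> 0 <= hco i (- x).
  by have [c cE] := h i; rewrite hcoN cE opprK.
have: aht (- x) = 0 by rewrite ahtN a0 oppr0.
by move=> /(psumr_eq0P h0) /(_ j isT) /eqP; rewrite hcoN oppr_eq0 => /eqP.
Qed.

Lemma real_aht_cases x : real_root x -> 0 < aht x \/ aht x < 0.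
Proof. by move=> /aht_neq0; case: ltgtP; auto. Qed.

Lemma hco_ge0 x : real_root x -> 0 < aht x ->
  forall j, exists c : nat, hco j x = c%:R.
Proof.
move=> xr x0; have [//|h] := real_sign xr.
suff : aht x <= 0 by lra.
by apply: sumr_le0 => j _; have [c ->] := h j; rewrite oppr_le0.
Qed.

(** Signs are never mixed, so a single coordinate decides; mostly used with [None], the
    delta-coefficient. *)
Lemma hco_gt0 x j : real_root x -> 0 < hco j x -> 0 < aht x.
Proof.
move=> xr xj; have [//|x0] := real_aht_cases xr.
have x0' : 0 < aht (- x) by rewrite ahtN; lra.
have [c] := hco_ge0 (real_opp xr) x0' j; rewrite hcoN => cE.
by have : (0 : R) <= c%:R by []; lra.
Qed.

Lemma aht_nat x : real_root x -> 0 < aht x -> exists c : nat, aht x = c%:R.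
Proof.
move=> xr x0; have h := hco_ge0 xr x0.
rewrite /aht; elim/big_ind: _ => [|a b [c ->] [d ->]|j _]; last exact: h.
  by exists 0.
by exists (c + d)%N; rewrite natrD.
Qed.

Lemma hat_posP x : hat_pos_roots Delta alpha x <-> real_root x /\ 0 < aht x.
Proof.
split=> [[[g [Dg g0] <-]|[g [k [Dg k1 ->]]]]|[[g [k [Dg ->]]] x0]].
- have xr : real_root (hat_inj g) by exists g, 0.
  split=> //; rewrite lt_def aht_neq0 //; apply: sumr_ge0 => -[i|] _ //=.
  have [c cE] := coord_root_le i g0; rewrite linear0 subr0 in cE.
  by rewrite scale0r addr0 cE.
- have xE : hat_inj g + hat_delta V *+ k = affine_root g k%:Z.
    have -> : hat_delta V *+ k = (0, k%:R, 0).
      elim: k {k1} => // k IH; rewrite mulrSr IH.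
      by congr (_, _, _); rewrite /= ?addr0 // natr1.
    by congr (_, _, _); rewrite /= ?addr0 ?add0r.
  have xr : real_root (hat_inj g + hat_delta V *+ k) by exists g, k%:Z.
  by split=> //; apply: (hco_gt0 (j := None)) => //; rewrite xE /= ltr0n.
case: (intP k) x0 => [|{}k|{}k] x0.
- left; exists g => //; split=> //.
  have [//|g0] := simple_sign halpha Dg.
  suff : aht (affine_root g 0) <= 0 by lra.
  apply: sumr_le0 => -[i|] _ //=.
  have [c cE] := coord_root_le i g0; rewrite linear0 sub0r in cE.
  by rewrite scale0r addr0 -[co i g]opprK cE oppr_le0.
- right; exists g, k.+1; split=> //.
  have -> : hat_delta V *+ k.+1 = (0, k.+1%:R, 0).
    elim: {x0} k => // k IH; rewrite mulrSr IH.
    by congr (_, _, _); rewrite /= ?addr0 // natr1.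
  by congr (_, _, _); rewrite /= ?addr0 ?add0r.
- have xr : real_root (affine_root g (- k.+1%:Z)) by exists g, (- k.+1%:Z).
  have [c] := hco_ge0 xr x0 None; rewrite /= => cE.
  have : (0 : R) <= c%:R by []; have : (0 : R) < k.+1%:R by rewrite ltr0n.
  by move: cE; rewrite mulrNz -[k.+1%:~R]/(k.+1%:R); lra.
Qed.

Lemma pos_rootP g : pos_roots Delta alpha g <->
  Delta g /\ 0 < aht (affine_root g 0).
Proof.
split=> [g0|[Dg g0]].
  have /hat_posP[_] : hat_pos_roots Delta alpha (hat_inj g) by left; exists g.
  by case: g0.
have [||[h [k [_ k0 hE]]]] := (hat_posP (affine_root g 0)).2.
- by split=> //; exists g, 0.
- by move=> [h h0 /(congr1 (fun x : hat => x.1.1)) hg]; rewrite -[g]hg.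
exfalso.
have /(congr1 (hco None)) := hE; rewrite hcoD /= => /eqP.
have -> : (hat_delta V *+ k).1.2 = k%:R :> R.
  by elim: (k) => // m IH; rewrite mulrSr -natr1 -IH.
by rewrite add0r eq_sym pnatr_eq0; case: (k) k0.
Qed.

(** Expanding one argument of (x, x) > 0 over the simple roots, with non-negative coefficients,
    leaves at least one positive term. *)
Lemma simple_pairing_pos x : real_root x -> 0 < aht x ->
  exists i, 0 < hco i x /\ 0 < hf x (asimple i).
Proof.
move=> xr x0; apply/not_existsP => h.
suff : hf x x <= 0.
  by case: xr => [g [k [Dg ->]]]; rewrite hf_affine; have := root_pos Dg; lra.
rewrite {2}[x]hco_expand ?real_lambda // hat_symm (form_suml hat_lin).
apply: sumr_le0 => j _; rewrite (formZl hat_lin) hat_symm.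
have [c cE] := hco_ge0 xr x0 j.
have := h j; rewrite cE; have : (0 : R) <= c%:R by [].
rewrite le_eqVlt => /predU1P[<-|c0]; first by rewrite mul0r.
move=> hj; rewrite pmulr_rle0 // leNgt; apply/negP => f0.
by apply: hj.
Qed.

Lemma simple_scale x i (c : R) : real_root x -> 0 < aht x ->
  x = c *: asimple i -> x = asimple i.
Proof.
move=> xr x0 xE; move: (x0); rewrite xE ahtZ aht_simple mulr1 => c0.
have [g [k [Dg gE]]] := xr; have [a [l [Da aE]]] := real_simple i.
have ga : g = c *: a.
  have := congr1 (fun x : hat => x.1.1) xE.
  by rewrite gE aE.
have [->|c1] : c = 1 \/ c = -1.
- by apply: (rs_reduced hDelta Da); rewrite -ga.
- by rewrite scale1r.
- by move: c0; rewrite c1 oppr_gt0 ltr10.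
Qed.

(** s_i changes only the i-th coordinate. A negative image would force all other coordinates of x to
    vanish, making x proportional to alpha_i. *)
Lemma refl_simple_pos x i : real_root x -> 0 < aht x -> x <> asimple i ->
  0 < aht (reflection hf (asimple i) x).
Proof.
move=> xr x0 xi; have yr := real_refl (real_simple i) xr.
have [//|y0] := real_aht_cases yr.
exfalso; apply: xi; apply: (@simple_scale x i (hco i x)) => //.
rewrite [LHS]hco_expand ?real_lambda // (bigD1 i) //= big1 ?addr0 // => j ji.
suff -> : hco j x = 0 by rewrite scale0r.
have y0' : 0 < aht (- reflection hf (asimple i) x) by rewrite ahtN; lra.
have [c cE] := hco_ge0 xr x0 j.
have [d dE] := hco_ge0 (real_opp yr) y0' j.
move: dE; rewrite (reflectionE hat_lin hat_symm) hcoN hcoD hcoN hcoZ.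
rewrite hco_simple eq_sym (negbTE ji) mulr0 subr0 cE => dE.
by have : (0 : R) <= c%:R by []; have : (0 : R) <= d%:R by []; lra.
Qed.

(** * The affine Weyl group *)

Local Notation srefl i := (reflection hf (asimple i)).
Local Notation waff := (affine_weyl ip alpha theta).

Definition act (l : seq (option 'I_n)) (x : hat) : hat :=
  foldr (fun i => srefl i) x l.

Lemma act_cat l m x : act (l ++ m) x = act l (act m x).
Proof. exact: foldr_cat. Qed.

Lemma act_lin l (c : R) x y : act l (c *: x + y) = c *: act l x + act l y.
Proof. by elim: l => //= i l ->; apply: (reflection_lin hat_lin). Qed.

Lemma actD l x y : act l (x + y) = act l x + act l y.
Proof. by rewrite -[x in LHS]scale1r act_lin scale1r. Qed.

Lemma act0 l : act l 0 = 0.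
Proof.
have /eqP := actD l 0 0.
by rewrite addr0 -subr_eq subrr eq_sym => /eqP.
Qed.

Lemma actZ l (c : R) x : act l (c *: x) = c *: act l x.
Proof. by rewrite -[c *: x]addr0 act_lin act0 addr0. Qed.

Lemma actN l x : act l (- x) = - act l x.
Proof. by rewrite -scaleN1r actZ scaleN1r. Qed.

Lemma act_isometry l x y : hf (act l x) (act l y) = hf x y.
Proof.
elim: l => //= i l <-.
by apply: (reflection_isometry hat_lin hat_symm); apply: real_aniso (real_simple i).
Qed.

Lemma act_real l x : real_root x -> real_root (act l x).
Proof. by move=> xr; elim: l => //= i l; apply: real_refl (real_simple i). Qed.

Lemma sreflK i x : srefl i (srefl i x) = x.
Proof.
exact: (reflectionK hat_lin hat_symm (real_aniso (real_simple i))).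
Qed.

Lemma act_revK l x : act (rev l) (act l x) = x.
Proof.
elim: l x => //= i l IH x.
by rewrite rev_cons -cats1 act_cat /= sreflK IH.
Qed.

Lemma actK_rev l x : act l (act (rev l) x) = x.
Proof. by rewrite -{1}[l]revK act_revK. Qed.

Lemma waffP w : waff w <-> exists l, w = act l.
Proof.
split=> [|[l ->]].
  elim=> [i||v w' _ [l ->] _ [m ->]|v v' _ [l ->] vK v'K].
  - by exists [:: i].
  - by exists [::].
  - by exists (l ++ m); apply/funext => x /=; rewrite act_cat.
  - exists (rev l); apply/funext => x.
    by rewrite -{1}[x](actK_rev l) vK.
elim: l => [|i l IH]; first exact: affine_weyl_id.
exact: affine_weyl_comp (affine_weyl_gen _ _ _ i) IH.
Qed.

Lemma refl_neg_simple i x : real_root x -> 0 < aht x ->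
  aht (srefl i x) < 0 -> x = asimple i.
Proof.
move=> xr x0 sx0; apply: contrapT => /(refl_simple_pos xr x0).
by rewrite ltNge ltW.
Qed.

(** Applying the letters from the right, the image of alpha_k turns negative at some letter j. Just
    before, it equals alpha_j, so s_k passes through the letters already applied, becomes s_j and
    cancels that letter. *)
Lemma exchange l k : aht (act l (asimple k)) < 0 ->
  exists2 m, (size m < size l)%N & forall x, act l (srefl k x) = act m x.
Proof.
elim: l => [|j l IH] /=; first by rewrite aht_simple ltr10.
have yr := act_real l (real_simple k).
have [y0 sy0|y0 _] := real_aht_cases yr; last first.
  have [m ml mE] := IH y0; exists (j :: m) => // x.
  by rewrite mE.
have yE := refl_neg_simple yr y0 sy0; exists l => // x.
rewrite (reflection_conj _ _ (act_lin l) (act_isometry l)) yE.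
exact: sreflK.
Qed.

(** For a word ending in k, positivity at alpha_k makes the preceding letters send alpha_k to a
    negative root, so [exchange] yields a shorter word with the same action. *)
Lemma act_id l : (forall i, 0 < aht (act l (asimple i))) ->
  forall x, act l x = x.
Proof.
have [N] := ubnP (size l); elim: N l => // N IH l.
case/lastP: l => [//|l k]; rewrite size_rcons ltnS => lN lpos x.
have lE y : act (rcons l k) y = act l (srefl k y).
  by rewrite -cats1 act_cat.
have [m ml mE] : exists2 m, (size m < size l)%N &
    forall x, act l (srefl k x) = act m x.
  apply: exchange; have := lpos k; rewrite lE.
  rewrite (reflection_self hat_lin hat_symm) ?real_aniso ?actN ?ahtN //.
    by rewrite oppr_gt0.
  exact: real_simple.
rewrite lE mE; apply: IH; first exact: leq_trans ml (ltnW lN).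
by move=> i; rewrite -mE -lE.
Qed.

Lemma inversionP l x : inversion_set Delta alpha (act l) x <->
  [/\ real_root x, 0 < aht x & aht (act l x) < 0].
Proof.
rewrite /inversion_set /= !hat_posP ahtN oppr_gt0.
split=> [[[xr x0] [_ y0]]|[xr x0 y0]]; first by [].
by split; split=> //; apply/real_opp/act_real.
Qed.

(** Uniqueness of w_I. For y = w^-1 alpha_i, either y is positive and not inverted by w, or -y is
    inverted by w; the same then holds for v, so v w^-1 keeps every simple root positive and
    [act_id] applies. *)
Lemma inversion_inj v w : waff v -> waff w ->
  inversion_set Delta alpha v = inversion_set Delta alpha w -> v = w.
Proof.
move=> /waffP[l ->] /waffP[m ->] N; apply/funext => x.
rewrite -[act m x](act_id (l := l ++ rev m)) => [|i].
  by rewrite act_cat act_revK.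
rewrite act_cat; set y := act (rev m) _.
have yr : real_root y by apply/act_real/real_simple.
have myE : act m y = asimple i by rewrite actK_rev.
have Ny z := (inversionP m z).2; rewrite -N in Ny.
have [y0|y0] := real_aht_cases yr.
  have [//|ly0] := real_aht_cases (act_real l yr).
  have : inversion_set Delta alpha (act l) y by apply/inversionP.
  rewrite N => /inversionP[_ _]; rewrite myE aht_simple ltNge ltW //.
have /Ny/inversionP[_ _] :
    [/\ real_root (- y), 0 < aht (- y) & aht (act m (- y)) < 0].
  split; first exact: real_opp.
    by rewrite ahtN oppr_gt0.
  by rewrite actN myE ahtN aht_simple oppr_lt0 ltr01.
by rewrite actN ahtN oppr_lt0.
Qed.

Lemma simple_descent x i : real_root x -> 0 < aht x ->
  0 < hf x (asimple i) -> x <> asimple i ->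
  exists2 y, [/\ real_root y, 0 < aht y & aht y < aht x] & x = srefl i y.
Proof.
move=> xr x0 fi xi; exists (srefl i x); last by rewrite sreflK.
split; [exact: real_refl (real_simple i) xr|exact: refl_simple_pos|].
rewrite (reflectionE hat_lin hat_symm) ahtD ahtN ahtZ aht_simple mulr1.
rewrite gtrDl oppr_lt0 (form_corootr hat_lin hat_symm).
rewrite divr_gt0 ?mulr_gt0 //.
by have [g [k [Dg ->]]] := real_simple i; rewrite hf_affine root_pos.
Qed.

Lemma real_height_ind (Q : hat -> Prop) :
  (forall x, real_root x -> 0 < aht x ->
     (forall y, real_root y -> 0 < aht y -> aht y < aht x -> Q y) -> Q x) ->
  forall x, real_root x -> 0 < aht x -> Q x.
Proof.
move=> step x xr x0; have [c cE] := aht_nat xr x0.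
have [N] := ubnP c; elim: N x c xr x0 cE => // N IH x c xr x0 cE cN.
apply: step => // y yr y0 yx; have [d dE] := aht_nat yr y0.
apply: (IH y d) => //; move: yx; rewrite cE dE ltr_nat => /leq_trans; exact.
Qed.

(** By induction on height: a non-simple positive root x is s_i y with y lower, and s_x = s_i s_y
    s_i. *)
Lemma reflection_word x : real_root x ->
  exists l, forall y, reflection hf x y = act l y.
Proof.
suff pos x' : real_root x' -> 0 < aht x' ->
    exists l, forall y, reflection hf x' y = act l y.
  move=> xr; have [/pos|x0] := real_aht_cases xr; first exact.
  have [||l lE] := pos (- x); [exact: real_opp|by rewrite ahtN oppr_gt0|].
  by exists l => y; rewrite -lE (reflectionN hat_lin hat_symm).
move: x'; apply: real_height_ind => y yr y0 IH.
move: y yr y0 IH => {}x xr x0 IH.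
have [[i ->]|xi] := pselect (exists i, x = asimple i).
  by exists [:: i].
have [i [_ fi]] := simple_pairing_pos xr x0.
have [|y [yr y0 yx] xE] := simple_descent xr x0 fi.
  by move=> xE; apply: xi; exists i.
have [l lE] := IH y yr y0 yx.
exists (i :: l ++ [:: i]) => z; rewrite /= act_cat /= -lE xE.
have sl := reflection_lin hat_lin (asimple i).
have si := reflection_isometry hat_lin hat_symm (real_aniso (real_simple i)).
by rewrite (reflection_conj _ _ sl si) sreflK.
Qed.

(** * The coroot lattice and translations *)

Local Notation Qv := (coroot_lattice ip alpha).

Lemma lattice_simple i : Qv (cor (alpha i)).
Proof.
exists (fun j => (j == i)%:R) => //.
rewrite /coroot_comb (bigD1 i) //= eqxx big1 ?addr0 // => j /negbTE ->.
by rewrite mulr0z.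
Qed.

Lemma latticeD x y : Qv x -> Qv y -> Qv (x + y).
Proof.
move=> [m _ <-] [k _ <-]; exists (fun i => m i + k i) => //.
by rewrite /coroot_comb -big_split; apply: eq_bigr => i _; rewrite /= mulrzDr.
Qed.

Lemma lattice_int m x : Qv x -> Qv (x *~ m).
Proof.
move=> [k _ <-]; exists (fun i => k i * m) => //.
rewrite /coroot_comb mulrz_suml; apply: eq_bigr => i _.
by rewrite mulrzA.
Qed.

Lemma latticeN x : Qv x -> Qv (- x).
Proof. by move=> /(lattice_int (-1)); rewrite mulrN1z. Qed.

Lemma lattice0 : Qv 0.
Proof.
by exists (fun=> 0) => //; rewrite /coroot_comb big1.
Qed.

(** A negative multiple of a simple coroot is a positive multiple of the coroot of -alpha_i, so
    closure under opposites need not be checked. *)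
Lemma lattice_ind (Q : V -> Prop) :
  Q 0 -> (forall x y, Q x -> Q y -> Q (x + y)) ->
  (forall g, Delta g -> Q (cor g)) -> forall x, Qv x -> Q x.
Proof.
move=> Q0 QD QC _ [m _ <-]; rewrite /coroot_comb.
elim/big_ind: _ => // i _; have Di := simple_root halpha i.
have Qn (k : nat) g : Delta g -> Q (cor g *+ k).
  by move=> Dg; elim: k => // k IH; rewrite mulrS; apply: QD => //; apply: QC.
case: (m i) => k; first exact: Qn.
rewrite NegzE mulrNz -mulNrz -corootN; apply: Qn.
exact: rootN.
Qed.

Lemma lattice_pairing_int q a : Qv q -> Delta a ->
  exists m : int, ip q a = m%:~R.
Proof.
move=> + Da; move: q; apply: lattice_ind => [|x y [k kE] [m mE]|g Dg].
- by exists 0; rewrite ip0l.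
- by exists (k + m); rewrite ipDl kE mE intrD.
- by rewrite ip_symm; apply: pairing_int.
Qed.

Lemma lattice_refl a q : Delta a -> Qv (cor a) -> Qv q -> Qv (refl a q).
Proof.
move=> Da Qa Qq; have [m mE] := lattice_pairing_int Qq Da.
rewrite /reflection mE scaler_int; apply: latticeD => //.
exact/latticeN/lattice_int.
Qed.

(** Descent by simple reflections, phrased for affine roots to reuse the height induction. The
    delta-coefficient stays 0, and since the chosen index has a positive coordinate, it is never
    that of alpha_0. *)
Lemma lattice_coroot g : Delta g -> Qv (cor g).
Proof.
suff pos x : real_root x -> 0 < aht x -> hco None x = 0 -> Qv (cor x.1.1).
  move=> Dg; have xr : real_root (affine_root g 0) by exists g, 0.
  have [x0|x0] := real_aht_cases xr; first exact: pos xr x0 _.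
  have x0' : 0 < aht (- affine_root g 0) by rewrite ahtN oppr_gt0.
  have := pos _ (real_opp xr) x0'; rewrite hcoN oppr0 => /(_ erefl).
  by rewrite /= corootN => /latticeN; rewrite opprK.
move: x; apply: real_height_ind => x xr x0 IH xN.
have [i [hi fi]] := simple_pairing_pos xr x0.
case: i hi fi => [i hi fi|]; last by rewrite xN ltxx.
have [xi|xi] := pselect (x = asimple (Some i)).
  by rewrite xi; apply: lattice_simple.
have [y [yr y0 yx] xE] := simple_descent xr x0 fi xi.
have yN : hco None y = 0.
  move: xN; rewrite xE (reflectionE hat_lin hat_symm) hcoD hcoN hcoZ.
  by rewrite hco_simple mulr0 subr0.
have Qy := IH y yr y0 yx yN.
have -> : x.1.1 = refl (alpha i) y.1.1.
  have [h [k [_ yE]]] := yr.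
  by rewrite xE yE affine_simple hat_reflE.
rewrite coroot_refl; last exact: simple_root halpha i.
apply: lattice_refl => //; last exact: lattice_simple.
exact: simple_root halpha i.
Qed.

Lemma reflection_lattice a q : Delta a -> Qv q -> Qv (refl a q).
Proof. by move=> Da Qq; apply: lattice_refl => //; apply: lattice_coroot. Qed.

(** The translation by g^vee is s_{delta - g} s_g. *)
Lemma translation_word z : Qv z -> exists l, forall (x : V) (k : R),
  act l (x, k, 0) = (x, k - ip z x, 0).
Proof.
move: z; apply: lattice_ind => [|x y [l lE] [m mE]|g Dg].
- by exists [::] => x k; rewrite /= ip0l subr0.
- exists (l ++ m) => z k; rewrite act_cat mE lE ipDl.
  by congr (_, _, _); ring.
have [|l lE] := @reflection_word (affine_root (- g) 1).
  by exists (- g), 1; split=> //; apply: rootN.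
have [|m mE] := @reflection_word (affine_root g 0).
  by exists g, 0.
exists (l ++ m) => x k; rewrite act_cat -mE -lE !hat_reflE.
rewrite (reflectionN ip_lin ip_symm) (reflectionK ip_lin ip_symm) ?root_aniso //.
congr (_, _, _); rewrite corootN (reflectionE ip_lin ip_symm) ipDl ipNl !ipNr ipZl.
rewrite (form_coroot_self ip_lin ip_symm) ?root_aniso //.
by rewrite (ip_symm (cor g)) /=; ring.
Qed.

(** The decomposition t_z v, with the translation applied last. Left multiplication by the
    reflection in a + m delta replaces v by s_a v and z by s_a z - m a^vee. *)
Lemma act_affine l : exists (v : V -> V) (z : V),
  [/\ Qv z, forall (x : V) (k : R), act l (x, k, 0) = (v x, k - ip z (v x), 0),
      forall g, Delta g -> Delta (v g) &
      forall g, Delta g -> exists2 h, Delta h & v h = g].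
Proof.
elim: l => [|i l [v [z [Qz lE vD vS]]]].
  exists id, 0; split=> //; first exact: lattice0.
    by move=> x k; rewrite ip0l subr0.
  by move=> g Dg; exists g.
have [a [m [Da aE]]] := real_simple i.
exists (refl a \o v), (refl a z - cor a *~ m); split.
- apply: latticeD; first exact: reflection_lattice.
  exact/latticeN/lattice_int/lattice_coroot.
- move=> x k; rewrite /= lE aE hat_reflE; congr (_, _, _).
  rewrite ipDl ipNl (formMzl ip_lin) /=.
  rewrite (reflection_isometry ip_lin ip_symm) ?root_aniso //.
  rewrite (reflectionE ip_lin ip_symm a (v x)).
  have := form_coroot_self ip_lin ip_symm (root_aniso Da).
  move: (cor a) => b ab; rewrite ipDr ipNr ipZr (ip_symm b a) ab.
  by rewrite (ip_symm b); ring.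
- by move=> g Dg /=; apply: rs_refl => //; apply: vD.
- move=> g Dg; have [h Dh hE] := vS _ (rs_refl hDelta Da Dg).
  by exists h => //=; rewrite hE (reflectionK ip_lin ip_symm) ?root_aniso.
Qed.


Lemma hco_lt0 x j : real_root x -> hco j x < 0 -> aht x < 0.
Proof.
move=> xr xj; rewrite -oppr_gt0 -ahtN.
by apply: (hco_gt0 (j := j)); rewrite ?hcoN ?oppr_gt0 //; apply: real_opp.
Qed.

Lemma real_affine g k : Delta g -> real_root (affine_root g k).
Proof. by exists g, k. Qed.

Lemma affine_rootN g k : - affine_root g k = affine_root (- g) (- k).
Proof. by rewrite /affine_root mulrNz; congr (_, _, _); rewrite /= oppr0. Qed.

Lemma affine_rootD g k h m :
  affine_root g k + affine_root h m = affine_root (g + h) (k + m).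
Proof. by rewrite /affine_root intrD; congr (_, _, _); rewrite /= addr0. Qed.

Lemma delta_sub g : hat_delta V - hat_inj g = affine_root (- g) 1.
Proof. by congr (_, _, _); rewrite /= ?subr0 ?sub0r. Qed.

Lemma act_delta l k : act l (affine_root 0 k) = affine_root 0 k.
Proof.
elim: l => //= i l ->; rewrite (reflectionE hat_lin hat_symm).
have -> : hf (affine_root 0 k) (coroot hf (asimple i)) = 0.
  have [g [m [_ ->]]] := real_simple i.
  by rewrite (form_corootr hat_lin hat_symm) hf_affine ip0l mulr0 mul0r.
by rewrite scale0r subr0.
Qed.

Lemma aht_delta k : 0 <= k -> 0 <= aht (affine_root 0 k).
Proof.
move=> k0; apply: sumr_ge0 => -[i|] _ /=; last by rewrite ler0z.
have [c cE] := coord_theta i.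
by rewrite linearD linear0 linearZ /= cE add0r mulr_ge0 ?ler0z.
Qed.

Lemma root_enum : exists D : seq V, uniq D /\ forall g, Delta g <-> g \in D.
Proof.
have /finite_seqP[D DE] := rs_finite hDelta.
by exists (undup D); rewrite undup_uniq; split=> // g; rewrite mem_undup DE.
Qed.

Lemma refl_perm (D : seq V) b : uniq D -> (forall g, Delta g <-> g \in D) ->
  Delta b -> perm_eq (map (refl b) D) D.
Proof.
move=> Du DE Db; have sK := reflectionK ip_lin ip_symm (root_aniso Db).
apply: uniq_perm => //; first by rewrite map_inj_uniq //; apply: can_inj sK.
move=> x; apply/mapP/idP => [[y /DE Dy ->]|/DE Dx].
  exact/DE/(rs_refl hDelta).
by exists (refl b x); [exact/DE/(rs_refl hDelta)|rewrite sK].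
Qed.

Lemma act_simple_pos l x : (forall i, 0 < aht (act l (asimple (Some i)))) ->
  real_root x -> hco None x = 0 -> 0 < aht x -> 0 < aht (act l x).
Proof.
move=> lpos xr xN x0; rewrite lt_def aht_neq0 /=; last exact: act_real.
rewrite [x]hco_expand ?real_lambda // sum_option xN scale0r add0r.
elim/big_ind: _ => [|a b a0 b0|i _].
- by rewrite act0 -(scale0r 0) ahtZ mul0r.
- by rewrite actD ahtD addr_ge0.
- have [c ->] := hco_ge0 xr x0 (Some i).
  by rewrite actZ ahtZ mulr_ge0 // ltW.
Qed.

(** * Minuscule elements and the range of z *)

(* On V + R delta, act l is v followed by the translation by z. *)
Definition translation_form z l (v : V -> V) :=
  (forall (x : V) (k : R), act l (x, k, 0) = (v x, k - ip z (v x), 0)) /\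
  (forall g, Delta g -> Delta (v g)).

(** Chooses in the coset t_z W an element positive on Pi: as long as some alpha_i goes negative,
    right multiplication by s_i keeps z and lowers the number of positive finite roots sent to
    negative ones. *)
Lemma dominant_word z : Qv z -> exists l v,
  translation_form z l v /\ forall i, 0 < aht (act l (asimple (Some i))).
Proof.
move=> Qz; have [D [Du DE]] := root_enum.
pose cnt l := count (fun g => (0 < aht (affine_root g 0)) &&
  (aht (act l (affine_root g 0)) < 0)) D.
suff main N l v : (cnt l < N)%N -> translation_form z l v -> exists l v,
    translation_form z l v /\ forall i, 0 < aht (act l (asimple (Some i))).
  have [l lE] := translation_word Qz.
  by apply: (main (cnt l).+1 l id).
elim: N l v => // N IH l v lN [lE vD].
have [lpos|/existsNP[i /negP]] :=
    pselect (forall i, 0 < aht (act l (asimple (Some i)))).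
  by exists l, v.
rewrite -leNgt => li.
have {}li : aht (act l (asimple (Some i))) < 0.
  by rewrite lt_neqAle li aht_neq0 //; apply/act_real/real_simple.
have Di := simple_root halpha i.
have sE g : srefl (Some i) (affine_root g 0) = affine_root (refl (alpha i) g) 0.
  by rewrite affine_simple hat_reflE mulr0 subr0.
have sK := reflectionK ip_lin ip_symm (root_aniso Di).
apply: (IH (l ++ [:: Some i]) (v \o refl (alpha i))); last first.
  split=> [x k|g Dg] /=; last exact/vD/(rs_refl hDelta).
  by rewrite act_cat /= /hat_inj hat_reflE mulr0 subr0 lE.
rewrite ltnS in lN; apply: leq_trans lN; rewrite {1}/cnt.
rewrite -(permP (refl_perm Du DE Di)) count_map.
(* After reindexing by s_i both counts test whether [act l] makes g negative; [alpha i] belongs to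
   the old count only. *)
apply: (@count_lt _ _ _ _ (alpha i)).
- exact/DE.
- by rewrite -[affine_root _ _]/(asimple (Some i)) aht_simple ltr01.
- rewrite /= (reflection_self ip_lin ip_symm (root_aniso Di)).
  rewrite -[affine_root _ _]/(affine_root (- alpha i) (- 0)) -affine_rootN.
  rewrite -[affine_root (alpha i) _]/(asimple (Some i)).
  by rewrite ahtN aht_simple oppr_gt0 ltNge ler01.
move=> g /DE Dg /=; rewrite act_cat /= -/(asimple (Some i)) -sE sreflK.
move=> /andP[s0 g0]; rewrite g0 andbT.
have [//|g0'] := real_aht_cases (real_affine 0 Dg).
have sr : real_root (srefl (Some i) (affine_root g 0)).
  by rewrite sE; apply/real_affine/(rs_refl hDelta).
have si : srefl (Some i) (affine_root g 0) = asimple (Some i).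
  by apply: refl_neg_simple; rewrite ?sreflK.
have gE : affine_root g 0 = - asimple (Some i).
  rewrite -[LHS](sreflK (Some i)) si.
  by rewrite (reflection_self hat_lin hat_symm) ?real_aniso //; apply: real_simple.
by move: g0; rewrite gE actN ahtN oppr_lt0 ltNge ltW.
Qed.

Lemma affine_root0N g : affine_root (- g) 0 = - affine_root g 0.
Proof. by rewrite affine_rootN oppr0. Qed.

Lemma hco_affine0 g k : hco None (affine_root g k) = k%:~R.
Proof. by []. Qed.

(* These are exactly the z_I, I in Ab (Kostant). *)
Definition short_range z := Qv z /\
  forall g, Delta g -> 0 < aht (affine_root g 0) -> -1 <= ip z g <= 2.

(** With h = v^-1 g and k = (z, g), w sends 2 delta - h to (2 + k) delta - g and 2 delta + h to (2 -
    k) delta + g, and both images must be positive. As g > 0, coefficient 0 is allowed only in the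
    second: hence the asymmetric bounds. *)
Lemma minuscule_short_range l v z (I : set V) : Qv z ->
  translation_form z l v ->
  (forall g, Delta g -> exists2 h, Delta h & v h = g) ->
  inversion_set Delta alpha (act l) = [set hat_delta V - hat_inj g | g in I] ->
  short_range z.
Proof.
move=> Qz [lE vD] vS N; split=> // g Dg g0.
have [h Dh hE] := vS g Dg.
have [k kE] := lattice_pairing_int Qz Dg.
have lhE m : act l (affine_root h m) = affine_root g (m - k).
  by rewrite /affine_root lE hE kE intrB.
have no2 x : real_root (affine_root x 2) -> ~ aht (act l (affine_root x 2)) < 0.
  move=> xr x0; have : inversion_set Delta alpha (act l) (affine_root x 2).
    apply/inversionP; split=> //; apply: (hco_gt0 (j := None)) => //.
  rewrite N => -[y _] /(congr1 (hco None)); rewrite delta_sub !hco_affine0.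
  by move=> /eqP; rewrite eqr_int.
rewrite kE -[-1]/((-1)%:~R) -[2]/(2%:~R) !ler_int; apply/andP; split.
  rewrite leNgt; apply/negP => k1; apply: (no2 (- h)).
    exact/real_affine/rootN.
  have -> : affine_root (- h) 2 = - affine_root h (- 2).
    by rewrite affine_rootN opprK.
  rewrite actN lhE ahtN oppr_lt0.
  have [k2|k2] := eqVneq (- 2 - k) 0; first by rewrite k2.
  apply: (hco_gt0 (j := None)); first exact: real_affine.
  by rewrite hco_affine0 ltr0z; lia.
rewrite leNgt; apply/negP => k2; apply: (no2 h); first exact: real_affine.
rewrite lhE; apply: (hco_lt0 (j := None)); first exact: real_affine.
by rewrite hco_affine0 ltrz0; lia.
Qed.

(** The bounds keep roots with delta-coefficient 2 positive ([pos2]), the choice of representative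
    does so for positive roots with coefficient 0 ([pos0]), and adding multiples of delta preserves
    this ([up]), so inversions have coefficient 1. Positivity on Pi makes I an upper ideal, and
    [pos2] at 2 delta - g1 - g2 makes it abelian. *)
Lemma short_range_minuscule z : short_range z -> exists l v I,
  [/\ translation_form z l v, Ab Delta alpha I &
      minuscule_with ip Delta alpha theta I (act l)].
Proof.
move=> [Qz zb]; have [l [v [[lE vD] lpos]]] := dominant_word Qz.
have pos2 h : Delta h -> 0 < aht (act l (affine_root h 2)).
  move=> Dh; have Dv := vD h Dh; have [k kE] := lattice_pairing_int Qz Dv.
  have -> : act l (affine_root h 2) = affine_root (v h) (2 - k).
    by rewrite /affine_root lE kE intrB.
  have [v0|v0] := real_aht_cases (real_affine 0 Dv).
    have /andP[_] := zb _ Dv v0.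
    rewrite kE -[2]/(2%:~R) ler_int => k2.
    have [k0|k0] := eqVneq (2 - k) 0; first by rewrite k0.
    apply: (hco_gt0 (j := None)); first exact: real_affine.
    by rewrite hco_affine0 ltr0z; lia.
  have v0' : 0 < aht (affine_root (- v h) 0).
    by rewrite affine_root0N ahtN oppr_gt0.
  have /andP[+ _] := zb _ (rootN Dv) v0'.
  rewrite ipNr kE -[-1]/((-1)%:~R) -mulrNz ler_int => k1.
  apply: (hco_gt0 (j := None)); first exact: real_affine.
  by rewrite hco_affine0 ltr0z; lia.
have pos0 h : Delta h -> 0 < aht (affine_root h 0) ->
    0 < aht (act l (affine_root h 0)).
  by move=> Dh; apply: act_simple_pos => //; apply: real_affine.
have up h k m : 0 <= m -> 0 < aht (act l (affine_root h k)) ->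
    0 < aht (act l (affine_root h (k + m))).
  move=> m0 h0; have -> : affine_root h (k + m) = affine_root h k + affine_root 0 m.
    by rewrite affine_rootD addr0.
  by rewrite actD act_delta ahtD ltr_wpDr // aht_delta.
pose I := [set g | pos_roots Delta alpha g /\
  aht (act l (affine_root (- g) 1)) < 0].
exists l, v, I; split=> //; last split.
- split=> [g [gp _]|nu mu [_ n0] mp [c cE]|g1 g2 [_ g10] [_ g20]].
    by [].
    split=> //.
    have -> : affine_root (- mu) 1
      = affine_root (- nu) 1 - affine_root (\sum_i alpha i *+ c i) 0.
      by rewrite affine_rootN affine_rootD -cE opprB addKr subr0.
    rewrite actD actN ahtD ahtN.
    suff : 0 <= aht (act l (affine_root (\sum_i alpha i *+ c i) 0)) by lra.
    elim/big_ind: _ => [|x y x0 y0|i _].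
    + by rewrite act_delta aht_delta.
    + have -> : affine_root (x + y) 0 = affine_root x 0 + affine_root y 0.
        by rewrite affine_rootD.
      by rewrite actD ahtD addr_ge0.
    + have -> : affine_root (alpha i *+ c i) 0 = (c i)%:R *: asimple (Some i).
        by rewrite -scaler_nat; congr (_, _, _); rewrite /= scaler0.
      by rewrite actZ ahtZ mulr_ge0 // ltW.
  move=> /pos_rootP[Dg _]; have := pos2 _ (rootN Dg).
  have -> : affine_root (- (g1 + g2)) 2
    = affine_root (- g1) 1 + affine_root (- g2) 1.
    by rewrite affine_rootD opprD.
  by rewrite actD ahtD; lra.
- by apply/waffP; exists l.
- by move=> g [/pos_rootP[]].
apply/seteqP; split=> [x /inversionP[[g [k [Dg ->]]] x0 lx0]|x [g [gp g0] <-]].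
  have [k1|k1] := eqVneq k 1; last exfalso.
    exists (- g); last by rewrite delta_sub opprK k1.
    split; last by rewrite opprK -k1.
    apply/pos_rootP; split; first exact: rootN.
    have [g0|g0] := real_aht_cases (real_affine 0 Dg); last first.
      by rewrite affine_root0N ahtN oppr_gt0.
    have := up g 0 1 isT (pos0 g Dg g0); rewrite add0r -k1 => ?; lra.
  have [k0|k0|k0] := ltgtP k 0.
  - have : aht (affine_root g k) < 0.
      by apply: (hco_lt0 (j := None)); [exact: real_affine|rewrite hco_affine0 ltrz0].
    lra.
  - have k2 : 0 <= k - 2 by lia.
    have := up g 2 (k - 2) k2 (pos2 g Dg); rewrite addrC subrK; lra.
  - rewrite k0 in x0 lx0; have := pos0 g Dg x0; lra.
have [Dg _] := (pos_rootP g).1 gp.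
rewrite delta_sub; apply/inversionP; split=> //.
  exact/real_affine/rootN.
apply: (hco_gt0 (j := None)); first exact/real_affine/rootN.
by rewrite hco_affine0 ltr0z.
Qed.

Lemma affine_root00 : affine_root 0 0 = 0.
Proof. by []. Qed.

Lemma root_le_aht nu mu : root_le alpha nu mu ->
  aht (affine_root mu 0) <= aht (affine_root nu 0) -> mu = nu.
Proof.
move=> numu; rewrite /aht !sum_option !hco_affine0 lerD2l -subr_le0 -sumrB.
move=> h; have d0 i : true -> 0 <= hco (Some i) (affine_root mu 0) -
    hco (Some i) (affine_root nu 0).
  by rewrite /= !scale0r !addr0; have [c ->] := coord_root_le i numu.
rewrite (simple_expand mu) (simple_expand nu); apply: eq_bigr => i _.
have /eqP : \sum_i (hco (Some i) (affine_root mu 0) -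
    hco (Some i) (affine_root nu 0)) = 0.
  by apply/eqP; rewrite eq_le h; apply: sumr_ge0.
move=> /eqP /(psumr_eq0P d0) /(_ i isT) /eqP.
by rewrite /= !scale0r !addr0 subr_eq0 => /eqP ->.
Qed.

(** * Minuscule elements from abelian ideals *)

(** Otherwise -y1 is inverted, so -y1 = delta - h with h in I. Then y2 = 2 delta - (g + h), making g
    + h a positive root, which is excluded. *)
Lemma root_sum_inversion l (I : set V) g y1 y2 :
  inversion_set Delta alpha (act l) = [set hat_delta V - hat_inj h | h in I] ->
  (forall h, I h -> pos_roots Delta alpha h /\ ~ pos_roots Delta alpha (g + h)) ->
  pos_roots Delta alpha g -> real_root y1 -> real_root y2 ->
  y1 + y2 = affine_root (- g) 1 -> 0 < aht (act l y1) -> 0 < aht y1.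
Proof.
move=> N Ig /pos_rootP[Dg g0] y1r y2r yE ly1.
have [//|y1neg] := real_aht_cases y1r.
have : inversion_set Delta alpha (act l) (- y1).
  apply/inversionP; split; first exact: real_opp.
  - by rewrite ahtN oppr_gt0.
  - by rewrite actN ahtN oppr_lt0.
rewrite N => -[h Ih]; rewrite delta_sub => hE.
have [/pos_rootP[Dh h0] nhg] := Ig h Ih; exfalso; apply: nhg.
apply/pos_rootP; split.
  have y2E : y2 = affine_root (- (g + h)) 2.
    have -> : y2 = affine_root (- g) 1 + (- y1) by rewrite -yE addrC addKr.
    by rewrite -hE affine_rootD opprD.
  have [k [m [Dk kE]]] := y2r.
  have := congr1 (fun x : hat => x.1.1) (esym y2E); rewrite kE /= => gh.
  by rewrite -[g + h]opprK gh; apply: rootN.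
have -> : affine_root (g + h) 0 = affine_root g 0 + affine_root h 0.
  by rewrite affine_rootD.
by rewrite ahtD addr_gt0.
Qed.

(** If w (delta - g) = alpha_i, then s_i w inverts exactly one root more than w, namely delta - g.
    The content is that this image is simple. *)
Lemma ideal_word_step l (I : set V) g :
  inversion_set Delta alpha (act l) = [set hat_delta V - hat_inj h | h in I] ->
  pos_roots Delta alpha g -> ~ I g ->
  (forall h, I h -> pos_roots Delta alpha h /\ ~ pos_roots Delta alpha (g + h)) ->
  (forall h, pos_roots Delta alpha h -> root_le alpha g h -> h <> g -> I h) ->
  exists m, inversion_set Delta alpha (act m)
    = [set hat_delta V - hat_inj h | h in g |` I].
Proof.
move=> N gp nIg Ig Iup; have [Dg g0] := (pos_rootP g).1 gp.
pose x := affine_root (- g) 1.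
have xr : real_root x by apply/real_affine/rootN.
have x0 : 0 < aht x by apply: (hco_gt0 (j := None)) => //; rewrite hco_affine0.
have NP z : inversion_set Delta alpha (act l) z ->
    exists2 h, I h & z = affine_root (- h) 1.
  by rewrite N => -[h Ih <-]; exists h; rewrite ?delta_sub.
have br : real_root (act l x) by apply: act_real.
have b0 : 0 < aht (act l x).
  have [//|xneg] := real_aht_cases br.
  have /NP[h Ih /(congr1 (fun z : hat => z.1.1)) /= /oppr_inj gh] :
    inversion_set Delta alpha (act l) x by apply/inversionP.
  by case: nIg; rewrite gh.
(* If the image of delta - g were not simple, it would be the sum of a simple
   root and of a positive root or a multiple of delta; pulling the summands
   back contradicts the ideal or the abelian condition. *)
have [i iE] : exists i, act l x = asimple i.
  apply: contrapT => /forallNP nsimple.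
  have [i [hi fi]] := simple_pairing_pos br b0.
  have [a [m [Da aE]]] := real_simple i.
  have [b [k [Db bE]]] := br.
  have b2nat j : 0 <= hco j (act l x - asimple i).
    rewrite hcoD hcoN hco_simple.
    have [c cE] := hco_ge0 br b0 j; have [<-|] := eqVneq i j; last first.
      by rewrite cE subr0.
    have [d dE] := hco_ge0 br b0 i.
    by move: hi; rewrite dE ltr0n subr_ge0 ler1n.
  pose y1 := act (rev l) (asimple i).
  have y1r : real_root y1 by apply/act_real/real_simple.
  have ly1 : act l y1 = asimple i by apply: actK_rev.
  have b2E : act l x - asimple i = affine_root (b - a) (k - m).
    by rewrite bE aE affine_rootN affine_rootD.
  (* If the remainder is a multiple of delta, then -y1 is g plus a non-negative multiple of delta
     and is inverted; this makes -g an element of I, hence positive. *)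
  have [ba|ba] := eqVneq b a.
    have km : 0 < k - m.
      have := b2nat None; rewrite b2E hco_affine0 ler0z le_eqVlt.
      move=> /predU1P[km|//]; case: (nsimple i).
      by rewrite -[LHS](subrK (asimple i)) b2E -km ba subrr affine_root00 add0r.
    have y1E : - y1 = affine_root g (k - m - 1).
      have -> : y1 = x - affine_root 0 (k - m).
        rewrite -(act_revK l (x - _)) actD actN act_delta.
        by rewrite -[act l x](subrK (asimple i)) b2E ba subrr addrC addKr.
      by rewrite opprB /x affine_rootN affine_rootD add0r opprK.
    have /NP[h /Ig[/pos_rootP[_ h0] _]] : inversion_set Delta alpha (act l) (- y1).
      apply/inversionP; split; first exact: real_opp.
        have -> : - y1 = affine_root g 0 + affine_root 0 (k - m - 1).
          by rewrite y1E affine_rootD addr0 add0r.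
        by rewrite ahtD ltr_wpDr // aht_delta //; lia.
      by rewrite actN ly1 ahtN aht_simple oppr_lt0.
    rewrite y1E => /(congr1 (fun z : hat => z.1.1)) /= gh.
    by move: g0; rewrite gh affine_root0N ahtN; lra.
  have b2r : real_root (act l x - asimple i).
    rewrite b2E; apply/real_affine/root_sub => //; last exact/eqP.
    by move: fi; rewrite bE aE hf_affine.
  pose y2 := act (rev l) (act l x - asimple i).
  have y2r : real_root y2 by apply: act_real.
  have ly2 : act l y2 = act l x - asimple i by apply: actK_rev.
  have ly2pos : 0 < aht (act l y2).
    by rewrite ly2 lt_def aht_neq0 //=; apply: sumr_ge0 => j _.
  have ly1pos : 0 < aht (act l y1) by rewrite ly1 aht_simple.
  have yE : y1 + y2 = x by rewrite -actD addrC subrK act_revK.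
  have yE' : y2 + y1 = x by rewrite addrC.
  have y1pos := root_sum_inversion N Ig gp y1r y2r yE ly1pos.
  have y2pos := root_sum_inversion N Ig gp y2r y1r yE' ly2pos.
  (* A positive summand with delta-coefficient 0 is a finite root h. The other summand is delta - (g
     + h) with g + h above g, hence in I, so it is inverted although its image is positive. *)
  have split z1 z2 : real_root z1 -> real_root z2 -> 0 < aht z2 ->
      z1 + z2 = x -> 0 < aht (act l z1) -> hco None z2 = 0 -> False.
    move=> z1r z2r z2pos zE lz1 z2N.
    have [h [p [Dh hE]]] := z2r.
    have p0 : p = 0.
      by move: z2N; rewrite hE hco_affine0 => /eqP; rewrite intr_eq0 => /eqP.
    rewrite p0 in hE; have hp : pos_roots Delta alpha h.
      by apply/pos_rootP; rewrite -hE.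
    have z1E : z1 = affine_root (- (g + h)) 1.
      have -> : z1 = x - z2 by rewrite -zE addrK.
      by rewrite hE affine_rootN affine_rootD opprD.
    have Dgh : Delta (g + h).
      have [d [q [Dd dE]]] := z1r; rewrite z1E in dE.
      have := congr1 (fun z : hat => z.1.1) dE; rewrite /= => gh.
      by rewrite -[g + h]opprK gh; apply: rootN.
    have Igh : I (g + h).
      apply: Iup.
      - apply/pos_rootP; split=> //.
        have -> : affine_root (g + h) 0 = affine_root g 0 + affine_root h 0.
          by rewrite affine_rootD.
        by rewrite ahtD addr_gt0 // -hE.
      - by have [_ [c cE]] := hp; exists c; rewrite addrC addrA addNr add0r -cE subr0.
      - move/eqP; rewrite -subr_eq0 addrC addrA addNr add0r => /eqP h00.
        by move: (root_neq0 Dh); rewrite h00 eqxx.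
    have : inversion_set Delta alpha (act l) z1.
      by rewrite N; exists (g + h) => //; rewrite delta_sub z1E.
    by move=> /inversionP[_ _]; rewrite ltNge ltW.
  (* The delta-coefficients are natural numbers with sum 1, so one of them is 0. *)
  have N12 : hco None y1 + hco None y2 = 1 by rewrite -hcoD yE.
  have [c1 c1E] := hco_ge0 y1r y1pos None.
  have [c2 c2E] := hco_ge0 y2r y2pos None.
  have /eqP : (c1 + c2)%:R = 1%:R :> R by rewrite natrD -c1E -c2E.
  rewrite eqr_nat => /eqP c12.
  have [c0|c0] : c1 = 0%N \/ c2 = 0%N by lia.
    by apply: (split y2 y1) => //; rewrite c1E c0.
  by apply: (split y1 y2) => //; rewrite c2E c0.
have linj z : act l z = asimple i -> z = x.
  by move=> zE; rewrite -[z](act_revK l) zE -iE act_revK.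
exists (i :: l); apply/seteqP; split=> [z /inversionP[zr z0 /= lz]|z].
  have [lz0|lz0] := real_aht_cases (act_real l zr).
    exists g; first by left.
    by rewrite delta_sub; apply/esym/linj/refl_neg_simple => //; apply: act_real.
  have : inversion_set Delta alpha (act l) z by apply/inversionP.
  by rewrite N => -[h Ih <-]; exists h => //; right.
move=> [h [->|Ih] <-].
  rewrite delta_sub; apply/inversionP; split=> //=.
  rewrite -/x iE (reflection_self hat_lin hat_symm) ?real_aniso //.
    by rewrite ahtN aht_simple oppr_lt0.
  exact: real_simple.
have /inversionP[hr h0 lh] :
    inversion_set Delta alpha (act l) (hat_delta V - hat_inj h).
  by rewrite N; exists h.
apply/inversionP; split=> //=; set y := hat_delta V - hat_inj h in hr h0 lh *.
rewrite -oppr_gt0 -ahtN -[srefl i _]/(act [:: i] _) -actN -actN /=.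
apply: refl_simple_pos.
- exact/act_real/real_opp.
- by rewrite actN ahtN oppr_gt0.
- by move=> /linj zx; move: x0; rewrite -zx ahtN; lra.
Qed.

(** Existence of w_I, by induction on the number of roots: removing a root of least height leaves an
    abelian ideal, and [ideal_word_step] puts it back. *)
Lemma ideal_word (I : set V) : Ab Delta alpha I -> exists l,
  inversion_set Delta alpha (act l) = [set hat_delta V - hat_inj g | g in I].
Proof.
have [D [Du DE]] := root_enum.
have [N] := ubnP (count (fun g => `[< I g >]) D).
elim: N I => // N IH I IN [Ipos Iup Iab].
have [[g0 Ig0]|] := pselect (I !=set0); last first.
  move=> /set0P/negP; rewrite negbK => /eqP ->; exists [::].
  rewrite image_set0; apply/seteqP; split=> // x /inversionP[_ x0 /=].
  by rewrite ltNge ltW.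
have nat_ht h : I h -> exists c : nat, aht (affine_root h 0) = c%:R.
  by move=> /Ipos/pos_rootP[Dh h0]; apply: aht_nat => //; apply: real_affine.
have [g Ig gmin] : exists2 g, I g &
    forall h, I h -> aht (affine_root g 0) <= aht (affine_root h 0).
  pose P c := `[< exists2 h, I h & aht (affine_root h 0) = c%:R >].
  have exP : exists c, P c.
    by have [c cE] := nat_ht _ Ig0; exists c; apply/asboolP; exists g0.
  case: (ex_minnP exP) => c /asboolP[g Ig gE] cmin; exists g => // h Ih.
  have [d dE] := nat_ht h Ih; rewrite gE dE ler_nat; apply: cmin.
  by apply/asboolP; exists h.
pose I' := I `\ g; have gp := Ipos g Ig.
have [||l lE] := IH I'.
- rewrite ltnS in IN; apply: leq_trans IN; apply: (@count_lt _ _ _ _ g).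
  + by apply/DE; have /pos_rootP[] := gp.
  + exact/asboolP.
  + by apply/asboolP => -[_]; apply.
  + by move=> y _ /asboolP[Iy _]; apply/asboolP.
- split=> [h [Ih _]|nu mu [In ng] mp nm|g1 g2 [I1 _] [I2 _]].
  + exact: Ipos.
  + split; first exact: Iup nm.
    move=> mg; apply: ng; rewrite /= -mg; apply/esym/(root_le_aht nm).
    by rewrite mg gmin.
  + exact: Iab.
- have gI : g |` I' = I by apply: setD1K.
  have [|h Ih|h hp gh hg|m mE] := ideal_word_step lE gp.
  + by move=> [_]; apply.
  + by split; [apply: Ipos; case: Ih|apply: Iab => //; case: Ih].
  + by split; [apply: Iup gh|].
  + by exists m; rewrite mE gI.
Qed.

(** * The coroot lattice modulo 2 *)

(* In a shortest expression of q as a sum of coroots the summands have pairwise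
   non-negative inner products, so q pairs to at least 2 with the root of each
   of them. *)
Lemma small_lattice_eq0 q : Qv q -> (forall g, Delta g -> ip q g <= 1) -> q = 0.
Proof.
move=> Qq q1.
have [s [sD sE]] : exists s : seq V, (forall b, b \in s -> Delta b) /\
    q = \sum_(b <- s) cor b.
  move: q Qq {q1}; apply: lattice_ind => [|x y [s [sD ->]] [t [tD ->]]|g Dg].
  - by exists [::]; rewrite big_nil.
  - exists (s ++ t); rewrite big_cat; split=> // b.
    by rewrite mem_cat => /orP[/sD|/tD].
  - by exists [:: g]; rewrite big_seq1; split=> // b; rewrite inE => /eqP ->.
have [N] := ubnP (size s); elim: N s sD sE => // N IH [|b s] sD sE sN.
  by rewrite sE big_nil.
have Db : Delta b by apply/sD/mem_head.
have [[b' b's bb']|nneg] := pselect (exists2 b', b' \in s & ip b b' < 0).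
  have Db' : Delta b' by apply: sD; rewrite in_cons b's orbT.
  have rD c : c \in rem b' s -> Delta c.
    by move=> /mem_rem cs; apply: sD; rewrite in_cons cs orbT.
  have sz : (size (rem b' s)).+1 = size s.
    by rewrite size_rem // prednK //; case: (s) b's.
  move: sN; rewrite /= -sz !ltnS => sN.
  have qE : q = (cor b + cor b') + \sum_(c <- rem b' s) cor c.
    by rewrite sE big_cons (perm_big _ (perm_to_rem b's)) big_cons addrA.
  have [h|[c Dc h]] := coroot_add Db Db' bb'; rewrite h in qE.
    by apply: (IH (rem b' s)) => //; [rewrite qE add0r|apply: ltnW].
  apply: (IH (c :: rem b' s)) => //; last by rewrite qE big_cons.
  by move=> d; rewrite in_cons => /predU1P[->//|/rD].
have := q1 b Db; rewrite sE (form_suml ip_lin) big_cons ip_symm.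
rewrite (form_coroot_self ip_lin ip_symm) ?root_aniso //.
suff : 0 <= \sum_(j <- s) ip (cor j) b by move=> ? ?; exfalso; clear sE; lra.
rewrite big_seq; apply: sumr_ge0 => c cs.
have Dc : Delta c by apply: sD; rewrite in_cons cs orbT.
rewrite ip_symm leNgt; apply/negP => bc0; apply: nneg; exists c => //.
rewrite ltNge; apply: contraTN bc0 => bc.
by rewrite -leNgt form_corootr // divr_ge0 ?mulr_ge0 // ltW // root_pos.
Qed.

(* The witness is the element of z0 + 2Q^vee nearest to rho^vee / h, with h the
   Coxeter number, for the invariant form sum_g (x, g)(y, g); scaling by h makes
   the squared distance M a natural number. *)
Lemma short_range_exists z0 : Qv z0 ->
  exists2 q, Qv q & short_range (z0 + q *~ 2).
Proof.
move=> Qz0; have [D [Du DE]] := root_enum.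
(* The height of delta = alpha_0 + theta is 1 + ht theta, the Coxeter number; [F z g] is h times (z
   - rho^vee / h, g). *)
pose h := aht (affine_root 0 1).
pose ht g := aht (affine_root g 0).
pose F z g := h * ip z g - ht g.
pose M z := \sum_(g <- D) (F z g) ^+ 2.
have ht_lt g : Delta g -> ht g < h.
  move=> Dg; have : 0 < aht (affine_root (- g) 1).
    by apply: (hco_gt0 (j := None)); rewrite ?hco_affine0 //; apply/real_affine/rootN.
  have -> : affine_root (- g) 1 = affine_root 0 1 - affine_root g 0.
    by rewrite affine_rootN affine_rootD add0r.
  by rewrite ahtD ahtN /h /ht; lra.
have ht_int g : Delta g -> exists m : int, ht g = m%:~R.
  move=> Dg; have gr := real_affine 0 Dg.
  have [g0|g0] := real_aht_cases gr.
    by have [c cE] := aht_nat gr g0; exists c%:Z.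
  have [|c] := aht_nat (real_opp gr); first by rewrite ahtN oppr_gt0.
  by rewrite ahtN => cE; exists (- c%:Z); rewrite mulrNz -[c%:~R]/(c%:R) -cE opprK.
have [t ht0] : exists t, Delta t /\ 0 < ht t.
  have Dt := htheta.1; have [t0|t0] := real_aht_cases (real_affine 0 Dt).
    by exists theta.
  by exists (- theta); split; [exact: rootN|rewrite /ht affine_root0N ahtN oppr_gt0].
have h0 : 0 < h by apply: lt_trans ht0.2 (ht_lt _ ht0.1).
have h_int : exists m : int, h = m%:~R.
  have Dt := htheta.1; have [m mE] := ht_int _ Dt.
  have ar : real_root (affine_root theta 1) by apply: real_affine.
  have a0 : 0 < aht (affine_root theta 1).
    by apply: (hco_gt0 (j := None)); rewrite ?hco_affine0.
  have [c cE] := aht_nat ar a0; exists (c%:Z - m).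
  rewrite intrD mulrNz -mE -[c%:~R]/(c%:R) -cE /h /ht.
  have -> : affine_root theta 1 = affine_root 0 1 + affine_root theta 0.
    by rewrite affine_rootD add0r.
  by rewrite ahtD addrK.
clearbody h.
have M_nat z : Qv z -> exists c : nat, M z = c%:R.
  move=> Qz; rewrite /M big_seq; elim/big_ind: _ => [|a b [c ->] [d ->]|g /DE Dg].
  - by exists 0%N.
  - by exists (c + d)%N; rewrite natrD.
  have [m mE] := h_int; have [k kE] := ht_int _ Dg.
  have [p pE] := lattice_pairing_int Qz Dg.
  exists (`|(m * p - k)%R| ^ 2)%N; rewrite /F mE kE pE natrX natr_absz.
  by rewrite -intrM -intrB intr_norm real_normK ?num_real.
have Qz q : Qv q -> Qv (z0 + q *~ 2) by move=> Qq; apply/latticeD/lattice_int.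
have [q Qq qmin] : exists2 q, Qv q &
    forall p, Qv p -> M (z0 + q *~ 2) <= M (z0 + p *~ 2).
  pose P c := `[< exists2 q, Qv q & M (z0 + q *~ 2) = c%:R >].
  have exP : exists c, P c.
    have [c cE] := M_nat _ (Qz _ lattice0); exists c; apply/asboolP.
    by exists 0 => //; apply: lattice0.
  case: (ex_minnP exP) => c /asboolP[q Qq qE] cmin; exists q => // p Qp.
  have [d dE] := M_nat _ (Qz _ Qp); rewrite qE dE ler_nat; apply: cmin.
  by apply/asboolP; exists p.
exists q => //; split=> [|b Db b0]; first exact: Qz.
set z := z0 + q *~ 2 in qmin *.
have bb : ip (cor b) b = 2.
  by rewrite ip_symm (form_coroot_self ip_lin ip_symm) // root_aniso.
pose C := \sum_(g <- D) ip (cor b) g ^+ 2.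
pose S := \sum_(g <- D) F z g * ip (cor b) g.
have C0 : 0 < C.
  have bD : b \in D by apply/DE.
  rewrite /C (perm_big _ (perm_to_rem bD)) big_cons bb /=.
  have : 0 <= \sum_(j <- rem b D) ip (cor b) j ^+ 2.
    by apply: sumr_ge0 => j _; apply: sqr_ge0.
  by apply: ltr_pwDl; rewrite exprn_gt0.
have htB g (c : R) : ht (g - c *: b) = ht g - c * ht b.
  rewrite /ht -ahtZ -ahtN -ahtD; congr aht.
  by rewrite /affine_root affineZD mulr0 subr0.
(* Reindexing by s_b negates (b^vee, g) and turns F(g) into F(g) - (b^vee, g) F(b), so the cross
   term depends on F(b) alone. *)
have SE : 2 * S = F z b * C.
  suff : S = - S + F z b * C by lra.
  rewrite {1}/S -(perm_big _ (refl_perm Du DE Db)) big_map /S /C.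
  rewrite mulr_sumr -sumrN -big_split; apply: eq_bigr => g _ /=.
  rewrite /F (reflectionE ip_lin ip_symm) (ip_symm _ (cor b)) htB.
  rewrite !ipDr !ipNr !ipZr bb.
  have alg (c x y k s r : R) : (c * (x - k * y) - (s - k * r)) * (k - k * 2)
      = - ((c * x - s) * k) + (c * y - r) * k ^+ 2 by ring.
  exact: alg.
have shift (e : R) : M (z - (e * 2) *: cor b)
    = M z - 4 * e * h * S + 4 * (e * h) ^+ 2 * C.
  rewrite /M /S /C !mulr_sumr -sumrN -!big_split; apply: eq_bigr => g _ /=.
  rewrite /F ipDl ipNl ipZl.
  have alg (c x k d s : R) : (c * (x - d * 2 * k) - s) ^+ 2
      = (c * x - s) ^+ 2 - 4 * d * c * ((c * x - s) * k) + 4 * (d * c) ^+ 2 * k ^+ 2.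
    ring.
  exact: alg.
have bound (e : R) : e ^+ 2 = 1 -> M z <= M (z - (e * 2) *: cor b) ->
    e * F z b <= 2 * h.
  move=> e1; rewrite shift => le; have : 0 <= 2 * h * (2 * h - e * F z b) * C.
    have -> : 2 * h * (2 * h - e * F z b) * C = 4 * h ^+ 2 * C - 2 * e * h * (F z b * C).
      by ring.
    by rewrite -SE; move: le; rewrite exprMn e1 mul1r; lra.
  by rewrite pmulr_lge0 // pmulr_rge0 ?mulr_gt0 // subr_ge0.
have shiftq (m : int) : z - (m%:~R * 2) *: cor b = z0 + (q - cor b *~ m) *~ 2.
  rewrite mulrzBl addrA -mulrzA; congr (_ - _).
  by rewrite -scaler_int intrM.
have Qb := lattice_coroot Db.
have up : 1 * F z b <= 2 * h.
  apply: bound; first by rewrite expr1n.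
  by rewrite (shiftq 1); apply/qmin/latticeD => //; apply/latticeN/lattice_int.
have lo : -1 * F z b <= 2 * h.
  apply: bound; first by rewrite sqrrN expr1n.
  by rewrite (shiftq (-1)); apply/qmin/latticeD => //; apply/latticeN/lattice_int.
have hb := ht_lt b Db; rewrite -/(ht b) in b0.
have [k kE] := lattice_pairing_int (Qz q Qq) Db; rewrite -/z in kE.
(* As 0 < ht b < h, the bound |h k - ht b| <= 2 h gives -2 < k < 3. *)
rewrite /F kE in up lo; rewrite kE -[-1]/((-1)%:~R) -[2]/(2%:~R) !ler_int.
apply/andP; split.
  rewrite leNgt; apply/negP => k1.
  have : (k%:~R : R) <= -2 by rewrite -[-2]/((-2)%:~R) ler_int; lia.
  by rewrite -(ler_pM2l h0); lra.
rewrite leNgt; apply/negP => k1.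
have : 3 <= (k%:~R : R) by rewrite -[3]/(3%:~R) ler_int; lia.
by rewrite -(ler_pM2l h0); lra.
Qed.

(** * From ideals to lattice elements and to sets of simple roots *)

Lemma hat_injD g (k : int) : hat_inj g + hat_delta V *~ k = affine_root g k.
Proof.
rewrite -scaler_int; congr (_, _, _); rewrite /= ?scaler0 ?addr0 //.
by rewrite add0r [_ *: _]mulr1.
Qed.

Lemma pairing_simple_inj z z' :
  (forall i, ip z (alpha i) = ip z' (alpha i)) -> z = z'.
Proof.
move=> h; apply/eqP; rewrite -subr_eq0; apply: contraT => /(ip_pos hip).
rewrite {2}[z - z']simple_expand ip_symm (form_suml ip_lin) big1 ?ltxx // => i _.
by rewrite ipZl ip_symm ipDl ipNl h subrr mulr0.
Qed.

Lemma w_ofE (I : set V) l : I `<=` Delta ->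
  inversion_set Delta alpha (act l) = [set hat_delta V - hat_inj g | g in I] ->
  w_of ip Delta alpha theta I = act l.
Proof.
move=> ID N; have lw : waff (act l) by apply/waffP; exists l.
apply: xget_unique => [|w [ww _ wN]]; first by split.
by apply: inversion_inj => //; rewrite wN.
Qed.

(** Comparing components in w (mu + k delta) = alpha_i gives v mu = alpha_i and k = (z, alpha_i), so
    every candidate for [xget] has the pairings of z with the simple roots. *)
Lemma z_ofE (I : set V) l v z : w_of ip Delta alpha theta I = act l ->
  Qv z -> translation_form z l v -> z_of ip Delta alpha theta I = z.
Proof.
move=> wE Qz [lE vD]; apply: xget_unique => [|z' [_ z'P]].
  split=> // i; have [mu [k [Dmu kE]]] := act_real (rev l) (real_simple (Some i)).
  exists mu, k; split=> //.
    by rewrite hat_injD wE -kE actK_rev.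
  have := actK_rev l (asimple (Some i)); rewrite kE /affine_root lE.
  move=> E; have vE := congr1 (fun x : hat => x.1.1) E.
  have := congr1 (hco None) E; rewrite /= in vE *; rewrite vE => /eqP.
  by rewrite subr_eq0 => /eqP.
apply: pairing_simple_inj => i; have [mu [k [Dmu kE ->]]] := z'P i.
rewrite hat_injD wE /affine_root lE in kE.
have vE := congr1 (fun x : hat => x.1.1) kE.
have := congr1 (hco None) kE; rewrite /= in vE *; rewrite vE => /eqP.
by rewrite subr_eq0 => /eqP.
Qed.

Lemma ideal_data (I : set V) : Ab Delta alpha I -> exists l v,
  let z := z_of ip Delta alpha theta I in
  [/\ inversion_set Delta alpha (act l) = [set hat_delta V - hat_inj g | g in I],
      translation_form z l v & short_range z].
Proof.
move=> Iab; have [l N] := ideal_word Iab.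
have [v [z [Qz lE vD vS]]] := act_affine l.
have ID : I `<=` Delta by case: Iab => Ip _ _ g /Ip/pos_rootP[].
have zE : z_of ip Delta alpha theta I = z.
  by apply: (z_ofE (w_ofE ID N) Qz); split; [exact: lE|].
exists l, v; rewrite zE; split=> //.
by apply: minuscule_short_range N.
Qed.

Lemma z_of_surj z : short_range z ->
  exists2 I, Ab Delta alpha I & z_of ip Delta alpha theta I = z.
Proof.
move=> zs; have [l [v [I [lE Iab [_ ID N]]]]] := short_range_minuscule zs.
by exists I => //; apply: z_ofE lE; [exact: w_ofE|case: zs].
Qed.

(** With equal translation parts, u = w_J^-1 w_I keeps delta-coefficient 0 on finite roots and 1 on
    alpha_0. Neither element inverts a finite root, so u keeps every simple root positive and is the
    identity. *)
Lemma z_of_inj (I J : set V) : Ab Delta alpha I -> Ab Delta alpha J ->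
  z_of ip Delta alpha theta I = z_of ip Delta alpha theta J -> I = J.
Proof.
move=> Iab Jab zIJ.
have [l [v [NI [lE vD] _]]] := ideal_data Iab.
have [m [w [NJ [mE wD] _]]] := ideal_data Jab.
rewrite -zIJ in mE; set z := z_of _ _ _ _ _ in lE mE.
have NP K k x : inversion_set Delta alpha (act k)
    = [set hat_delta V - hat_inj g | g in K] -> real_root x -> 0 < aht x ->
    hco None x = 0 -> 0 < aht (act k x).
  move=> N xr x0 xN; have [//|kx] := real_aht_cases (act_real k xr).
  have : inversion_set Delta alpha (act k) x by apply/inversionP.
  rewrite N => -[g _ gE]; move: xN; rewrite -gE delta_sub hco_affine0.
  by move/eqP; rewrite intr_eq0.
pose u x := act (rev m) (act l x).
have u0 g : Delta g -> hco None (u (affine_root g 0)) = 0.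
  move=> Dg; have [h [k [Dh hE]]] : real_root (u (affine_root g 0)).
    by apply/act_real/act_real/real_affine.
  have := actK_rev m (act l (affine_root g 0)); rewrite -/(u _) hE.
  rewrite /affine_root mE lE => E.
  have vE := congr1 (fun x : hat => x.1.1) E.
  have := congr1 (hco None) E; rewrite /= in vE *; rewrite vE sub0r => /eqP.
  by rewrite -subr_eq0 opprK subrK => /eqP.
have uE : forall x, act (rev m ++ l) x = x.
  apply: act_id => i; rewrite act_cat -/(u _).
  case: i => [i|]; last first.
    apply: (hco_gt0 (j := None)); first exact/act_real/act_real/real_simple.
    rewrite affine_simple0.
    have -> : affine_root (- theta) 1 = affine_root 0 1 - affine_root theta 0.
      by rewrite affine_rootN affine_rootD add0r.
    rewrite /u !actD !act_delta !actN hcoD hcoN -/(u _) u0 ?subr0 ?hco_affine0 //.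
    exact: htheta.1.
  have Di := simple_root halpha i; have ar := real_affine 0 Di.
  have ur : real_root (u (affine_root (alpha i) 0)) by apply/act_real/act_real.
  have li : 0 < aht (act l (affine_root (alpha i) 0)).
    by apply: NP NI ar _ _ => //; rewrite -[affine_root _ _]/(asimple (Some i)) aht_simple.
  have [//|uneg] := real_aht_cases ur.
  have : 0 < aht (act m (- u (affine_root (alpha i) 0))).
    apply: NP NJ _ _ _; first exact: real_opp.
      by rewrite ahtN oppr_gt0.
    by rewrite hcoN u0 ?oppr0.
  by rewrite actN actK_rev ahtN oppr_gt0 ltNge ltW.
have lm : act l = act m.
  by apply/funext => x; rewrite -[in RHS](uE x) act_cat actK_rev.
have sub (K L : set V) : [set hat_delta V - hat_inj g | g in K]
    = [set hat_delta V - hat_inj g | g in L] -> K `<=` L.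
  move=> KL g Kg.
  have [h Lh] : [set hat_delta V - hat_inj g | g in L] (hat_delta V - hat_inj g).
    by rewrite -KL; exists g.
  by rewrite !delta_sub => /(congr1 (fun x : hat => x.1.1)) /= /oppr_inj <-.
have IJ : [set hat_delta V - hat_inj g | g in I]
    = [set hat_delta V - hat_inj g | g in J] by rewrite -NI -NJ lm.
by apply/seteqP; split; apply: sub.
Qed.

Lemma simple_inj : injective alpha.
Proof.
move=> i j ij; have := coord_simple i j.
rewrite -ij coord_simple eqxx; case: eqVneq => [-> //|_ /eqP].
by rewrite oner_eq0.
Qed.

Lemma coroot_comb_inj (m m' : 'I_n -> int) :
  coroot_comb ip alpha m = coroot_comb ip alpha m' -> m =1 m'.
Proof.
have coE k i : co i (coroot_comb ip alpha k)
    = (k i)%:~R * (2 / ip (alpha i) (alpha i)).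
  rewrite /coroot_comb linear_sum (bigD1 i) //= big1 => [|j ji].
    by rewrite addr0 -scaler_int /coroot !linearZ /= coord_simple eqxx mulr1.
  by rewrite -scaler_int /coroot !linearZ /= coord_simple (negbTE ji) !mulr0.
move=> mm' i; have := congr1 (co i) mm'; rewrite !coE => /mulIf h.
apply/eqP; rewrite -(eqr_int R); apply/eqP/h.
by rewrite mulf_neq0 ?invr_eq0 ?root_aniso ?pnatr_eq0 //; apply: simple_root halpha _.
Qed.

(** [S_of] quantifies over coefficient families; independence of the simple coroots lets any one
    family decide membership. *)
Lemma S_ofE (I : set V) (m : 'I_n -> int) i :
  z_of ip Delta alpha theta I = coroot_comb ip alpha m ->
  S_of ip Delta alpha theta I (alpha i) <-> odd `|m i|%N.
Proof.
move=> zE; split=> [[m' [j [m'E oj /simple_inj ->]]]|oi]; last by exists m, i.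
by rewrite (coroot_comb_inj (m' := m')) // -zE m'E.
Qed.

Lemma S_of_inj (I J : set V) : Ab Delta alpha I -> Ab Delta alpha J ->
  S_of ip Delta alpha theta I = S_of ip Delta alpha theta J -> I = J.
Proof.
move=> Iab Jab SIJ; apply: z_of_inj => //.
have [_ [_ [_ _ [[m _ mE] mb]]]] := ideal_data Iab.
have [_ [_ [_ _ [[m' _ m'E] m'b]]]] := ideal_data Jab.
have par i : odd `|m i|%N = odd `|m' i|%N.
  have := S_ofE i (esym mE); rewrite SIJ => h1.
  have h2 := S_ofE i (esym m'E).
  by apply/idP/idP => [/h1/h2|/h2/h1].
(* The division is exact because the parities agree. *)
pose q i := ((m i - m' i) %/ 2)%Z.
have qE i : m i = m' i + q i * 2 by have := par i; rewrite /q; lia.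
have zE : coroot_comb ip alpha m
    = coroot_comb ip alpha m' + coroot_comb ip alpha q *~ 2.
  rewrite /coroot_comb mulrz_suml -big_split; apply: eq_bigr => i _ /=.
  by rewrite -mulrzA -mulrzDr qE.
have Qq : Qv (coroot_comb ip alpha q) by exists q.
rewrite -mE -m'E in mb m'b *; rewrite zE (small_lattice_eq0 Qq) => [|g Dg].
  by rewrite mul0rz addr0.
have [k kE] := lattice_pairing_int Qq Dg; rewrite kE.
(* Two values in [-1, 2] differ by at most 3 = 2 - (-1), and 2 k <= 3 gives k <= 1 for an integer.
   For negative g the bounds at -g give the same. *)
suff : 2 * (k%:~R : R) <= 3.
  move=> k3; have {}k3 : 2 * k <= 3 by rewrite -(ler_int R) intrM.
  have : k <= 1 by lia.
  by rewrite -(ler_int R).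
rewrite zE in mb.
have zg h : ip (coroot_comb ip alpha m' + coroot_comb ip alpha q *~ 2) h
    = ip (coroot_comb ip alpha m') h + 2 * ip (coroot_comb ip alpha q) h.
  by rewrite ipDl (formMzl ip_lin).
have [g0|g0] := real_aht_cases (real_affine 0 Dg).
  by have := mb g Dg g0; have := m'b g Dg g0; rewrite zg kE; lra.
have g0' : 0 < aht (affine_root (- g) 0) by rewrite affine_root0N ahtN oppr_gt0.
have := mb _ (rootN Dg) g0'; have := m'b _ (rootN Dg) g0'.
by rewrite zg !ipNr kE; lra.
Qed.

Lemma S_of_surj (S : set V) : S `<=` range alpha ->
  exists2 I, Ab Delta alpha I & S_of ip Delta alpha theta I = S.
Proof.
move=> Sa; pose m i : int := `[< S (alpha i) >]%:R.
have Qm : Qv (coroot_comb ip alpha m) by exists m.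
have [_ [q _ <-] zs] := short_range_exists Qm.
have [I Iab zE] := z_of_surj zs; exists I => //.
have {}zE : z_of ip Delta alpha theta I
    = coroot_comb ip alpha (fun i => m i + q i * 2).
  rewrite zE /coroot_comb mulrz_suml -big_split; apply: eq_bigr => i _ /=.
  by rewrite -mulrzA -mulrzDr.
have oddE i : odd `|(m i + q i * 2)%R|%N = `[< S (alpha i) >].
  by rewrite /m; case: `[< _ >]; lia.
apply/seteqP; split=> [x [m' [i [m'E oi ->]]]|x Sx].
  apply/asboolP; rewrite -oddE; apply/(S_ofE i zE).
  by exists m', i.
have [i _ iE] := Sa x Sx; rewrite -iE in Sx *.
by apply/(S_ofE i zE); rewrite oddE; apply/asboolP.
Qed.
End AbelianIdeals.

Theorem theorem3p1 (R : realType) (V : vectType R) (ip : V -> V -> R)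
    (Delta : set V) (n : nat) (alpha : 'I_n -> V) (theta : V)
    (hip : inner_product ip)
    (hDelta : root_system ip Delta)
    (hirr : irreducible_system ip Delta)
    (halpha : simple_roots Delta alpha)
    (htheta : highest_root Delta alpha theta) :
  set_bij (Ab Delta alpha) [set S : set V | S `<=` range alpha]
    (S_of ip Delta alpha theta).
Proof.
split=> [I _ x [m [i [_ _ ->]]]|I J /set_mem Iab /set_mem Jab|S Sa].
- by exists i.
- exact: (S_of_inj hip hDelta halpha htheta).
- by have [I Iab <-] := S_of_surj hip hDelta halpha htheta Sa; exists I.
Qed.
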